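(* Let $\alpha\in(0,2)\setminus\{1\}$ and $p\ge1$. Let $k_0>0$ and let $(\omega_n)_{n\in\mathbb{Z}}$ be a positive weight sequence such that the sequence $(k_n)_{n\in\mathbb{Z}}$ defined by $$k_n:=k_0\mathbf{1}_{\{n\le-1\}}\prod_{l=n+1}^0\frac1{\omega_l}+k_0\mathbf{1}_{\{n\ge0\}}\prod_{l=1}^n\omega_l$$ belongs to $\ell^\alpha(\mathbb{Z})$. Let $\mu$ be the $\alpha$-stable measure on the complex space $E=\ell^p(\mathbb{Z})$ with characteristic functional $$\int_E e^{i\mathrm{Re}\langle z,x^*\rangle}\mu(dz)=\exp\Big(-\int_E|\mathrm{Re}\langle z,x^*\rangle|^\alpha\,\xi(dz)\Big),\quad x^*\in E^*,$$ and control measure $$\xi(dz):=\frac12\sum_{n=-\infty}^\infty k_n^\alpha\big(\delta_{e_n}(dz)+\delta_{ie_n}(dz)\big),$$ and consider the weighted forward shift operator $T$ on $E$ defined by $Te_n:=\omega_{n+1}e_{n+1}$, $n\in\mathbb{Z}$, assumed to be bounded. Then: 1. $T$ admits $\mu$ as invariant measure. 2. Assume that $p\in(\alpha,2]\cap[1,2]$ and that there exist $q_-\ge0$, $q_+\ge1$ such that $$\eta_-:=\sup_{l\le-q_-}\frac1{\omega_l}<1\quad\text{and}\quad\eta_+:=\sup_{l\ge q_+}\omega_l<1,$$ with $\eta_+^{p/2}\ne\eta_-^{\alpha-p/2}$. Then $$\sup_{x^*,y^*\in E^*\setminus\{0\}}\frac{|C_\mu^{=,\neq}(x^*,T^{*n}y^*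 )|}{\|x^*\|^{\alpha/2}\|y^*\|^{\alpha/2}}=O_{\mu,T}\Big(\max\big(\eta_-^{2\alpha/p-1},\eta_+\big)^{\alpha n/2}\Big),\quad n\ge0,$$ where $C_\mu^{=,\neq}$ denotes either of $C_\mu^{=}$ and $C_\mu^{\neq}$. In particular, under these assumptions, $T$ is mixing with respect to $\mu$ when $\alpha\in(1/2,2)\setminus\{1\}$ and $p\in(\alpha,2\alpha)\cap[1,2]$.
   Context: $(e_n)_{n\in\mathbb{Z}}$ is the canonical basis of $\ell^p(\mathbb{Z})$, $\delta_x$ the Dirac measure at $x$, $\langle\cdot,\cdot\rangle:E\times E^*\to\mathbb{C}$ the duality with the continuous dual $E^*$, $T^*$ the adjoint, $\langle z,T^*x^*\rangle=\langle Tz,x^*\rangle$. $f(n)=O_{\mu,T}(g(n))$, $n\ge0$, means $|f(n)|\le C|g(n)|$ for all $n\ge0$ with a constant $C>0$ that may depend on $\mu,T$ but not on $n$. Codifferences. For $x^*,y^*\in E^*$, $$C^{=}_\mu(x^*,y^* ):=\log\int_E e^{i\mathrm{Re}\langle z,x^*-y^*\rangle}\mu(dz)-\log\int_E e^{i\mathrm{Re}\langle z,x^*\rangle}\mu(dz)-\log\int_E e^{-i\mathrm{Re}\langle z,y^*\rangle}\mu(dz),$$ $$C^{\neq}_\mu(x^*,y^* ):=\log\int_E e^{i\mathrm{Re}\langle z,x^*\rangle-i\mathrm{Im}\langle z,y^*\rangle}\mu(dz)-\log\int_E e^{i\mathrm{Re}\langle z,x^*\rangle}\mu(dz)-\log\int_E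 e^{-i\mathrm{Im}\langle z,y^*\rangle}\mu(dz),$$ where $\log$ of the characteristic functional $x^*\mapsto\int_E e^{i\mathrm{Re}\langle z,x^*\rangle}\mu(dz)$ is its Lévy–Khintchine exponent (here $-\int_E|\mathrm{Re}\langle z,x^*\rangle|^\alpha\xi(dz)$); note $-\mathrm{Im}\langle z,y^*\rangle=\mathrm{Re}\langle z,iy^*\rangle$. $T$ admits $\mu$ as invariant measure if $\mu(T^{-1}(A))=\mu(A)$ for all Borel $A\subset E$. $T$ is mixing if $\lim_{n\to\infty}\mu(A\cap T^{-n}(B))=\mu(A)\mu(B)$ for all Borel $A,B\subset E$. *)

(* Defs.v *)
From HB Require Import structures.
From mathcomp Require Import all_boot all_order all_algebra.
From mathcomp Require Import all_classical all_reals all_analysis.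

Set Implicit Arguments.
Unset Strict Implicit.
Unset Printing Implicit Defensive.

Import Order.TTheory GRing.Theory Num.Theory.
Import numFieldNormedType.Exports.
(* required after Num.Theory so that Re and Im are the projections of R[i] *)
From mathcomp Require Import complex.
Import ComplexField.Normc.

Local Open Scope classical_set_scope.
Local Open Scope complex_scope.
Local Open Scope ring_scope.

(* Mind that the norm `|z| of z : R[i] is itself in R[i]; normc z is in R. *)

Definition lp_esum (R : realType) (p : R) (f : int -> R[i]) : \bar R :=
  \esum_(n in [set: int]) (normc (f n) `^ p)%:E.

HB.lock Definition lp_norm (R : realType) (p : R) (f : int -> R[i]) : R :=
  fine (lp_esum p f) `^ p^-1.
Canonical locked_lp_norm := Unlockable lp_norm.unlock.

Definition lp_pred (R : realType) (p : R) : {pred int -> R[i]} :=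
  mem [set f | (lp_esum p f < +oo)%E].

Section sequence_space.
Context {R : realType}.
Implicit Types (p : R) (f g : int -> R[i]).

Let int_of_nat (m : nat) : int := if odd m then Negz m./2 else Posz m./2.

Let int_of_nat_bij : set_bij [set: nat] [set: int] int_of_nat.
Proof.
split => //.
- move=> m n _ _; rewrite /int_of_nat.
  have := odd_double_half m; have := odd_double_half n.
  by case: (odd m); case: (odd n) => // hn hm [e]; rewrite -hm e.
- move=> [m|m] _ /=.
  + by exists m.*2 => //; rewrite /int_of_nat odd_double doubleK.
  + exists m.*2.+1 => //; rewrite /int_of_nat.
    by rewrite oddS odd_double /= uphalf_double.
Qed.

Let normc_ge0 (z : R[i]) : 0 <= normc z.
Proof. by case: z => a b; exact: sqrtr_ge0. Qed.

Let nnseries p f : lp_esum p f =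
  (\sum_(m <oo) (normc (f (int_of_nat m)) `^ p)%:E)%E.
Proof.
rewrite /lp_esum (reindex_esum _ _ _ _ int_of_nat_bij).
by rewrite -nneseries_esumT// => n; rewrite lee_fin powR_ge0.
Qed.

Let Lnorm_lp p f : 0 < p ->
  Lnorm (@counting nat R) p%:E (EFin \o (@normc R \o f \o int_of_nat)) =
  (lp_esum p f `^ p^-1)%E.
Proof.
move=> p0; rewrite Lnorm_counting// nnseries; congr poweR.
by apply: eq_eseriesr => n _ /=; rewrite ger0_norm.
Qed.

Lemma lp_esum_ge0 p f : (0 <= lp_esum p f)%E.
Proof. by apply: esum_ge0 => n _; rewrite lee_fin powR_ge0. Qed.

Lemma lp_predE p f : (f \in lp_pred p) = (lp_esum p f < +oo)%E.
Proof. by apply/idP/idP; rewrite inE. Qed.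

Lemma lp_normE p f : f \in lp_pred p -> (lp_norm p f)%:E = (lp_esum p f `^ p^-1)%E.
Proof.
rewrite lp_predE => fp; rewrite unlock -poweR_EFin fineK//.
by rewrite ge0_fin_numE// lp_esum_ge0.
Qed.

Let lp_esum_lty p f : 0 < p ->
  (lp_esum p f < +oo)%E = (lp_esum p f `^ p^-1 < +oo)%E.
Proof.
move=> p0; apply/idP/idP; first exact: poweR_lty.
by apply: lty_poweRy; rewrite invr_neq0// gt_eqF.
Qed.

Lemma lp_minkowski p f g : 1 <= p ->
  (lp_esum p (f + g)%R `^ p^-1 <= lp_esum p f `^ p^-1 + lp_esum p g `^ p^-1)%E.
Proof.
move=> p1; have p0 : 0 < p by exact: lt_le_trans p1.
pose u (h : int -> R[i]) (m : nat) : R := normc (h (int_of_nat m)).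
rewrite -!Lnorm_lp//.
have := @minkowski_EFin _ _ _ (@counting nat R) (u f) (u g) p.
move=> /(_ _ _ p1) mink; apply: le_trans (mink _ _) => // {mink}.
rewrite !Lnorm_counting//; apply: gt0_ler_poweR.
- by rewrite invr_ge0 ltW.
- by rewrite in_itv/= leey andbT nneseries_ge0// => n _ _; exact: poweR_ge0.
- by rewrite in_itv/= leey andbT nneseries_ge0// => n _ _; exact: poweR_ge0.
apply: lee_nneseries => n _; first by move=> _; exact: poweR_ge0.
rewrite /= lee_fin; apply: ge0_ler_powR; rewrite ?nnegrE ?normr_ge0 ?(ltW p0)//.
by rewrite !ger0_norm ?addr_ge0 /u ?normc_ge0//; exact: le_normcD.
Qed.

Lemma lp_esumZ p (a : R[i]) f : 0 < p ->
  (lp_esum p (a *: f)%R `^ p^-1 = (normc a)%:E * lp_esum p f `^ p^-1)%E.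
Proof.
move=> p0; rewrite !nnseries.
under eq_eseriesr do rewrite normcM powRM// EFinM.
rewrite nneseriesZl//; last by move=> n _; rewrite lee_fin powR_ge0.
rewrite poweRM ?lee_fin ?powR_ge0//; last first.
  by apply: nneseries_ge0 => n _ _; rewrite lee_fin powR_ge0.
by rewrite poweR_EFin -powRrM mulfV ?gt_eqF// powRr1.
Qed.

Lemma lp_submod_closed p : 1 <= p -> submod_closed (lp_pred p).
Proof.
move=> p1; have p0 : 0 < p by exact: lt_le_trans p1.
split=> [|a f g].
  rewrite lp_predE /lp_esum esum1// => n _.
  by rewrite (@normc0 R) powR0// gt_eqF.
rewrite !lp_predE !lp_esum_lty// => fp gp.
apply: le_lt_trans (lp_minkowski _ _ p1) _.
rewrite lp_esumZ// lte_add_pinfty// lte_mul_pinfty//.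
by rewrite lee_fin.
Qed.

Lemma lp_normD p f g : 1 <= p -> f \in lp_pred p -> g \in lp_pred p ->
  lp_norm p (f + g) <= lp_norm p f + lp_norm p g.
Proof.
move=> p1 fp gp; have [_ lpD] := lp_submod_closed p1.
have fgp : f + g \in lp_pred p by have := lpD 1 f g fp gp; rewrite scale1r.
by rewrite -lee_fin EFinD !lp_normE// lp_minkowski.
Qed.

Lemma lp_normZ p (a : R[i]) f : 1 <= p -> f \in lp_pred p ->
  lp_norm p (a *: f) = normc a * lp_norm p f.
Proof.
move=> p1 fp; have [lp0 lpD] := lp_submod_closed p1.
have afp : a *: f \in lp_pred p by have := lpD a f 0 fp lp0; rewrite addr0.
apply: EFin_inj; rewrite EFinM !lp_normE// lp_esumZ//.
exact: lt_le_trans p1.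
Qed.

Lemma lp_norm_eq0 p f : 0 < p -> f \in lp_pred p -> lp_norm p f = 0 -> f = 0.
Proof.
move=> p0 fp nf0; have := lp_normE fp; rewrite nf0 => /esym pf0.
have f0 := poweR_eq0_eq0 (lp_esum_ge0 p f) pf0; apply/funext => n.
have : ((normc (f n) `^ p)%:E <= 0)%E.
  rewrite -f0; apply: esum_ge; exists [set n]; first by split.
  by rewrite fsbig_set1.
rewrite lee_fin => fn0; apply: eq0_normc; apply: (@powR_eq0_eq0 _ _ p).
by apply/eqP; rewrite eq_le fn0 powR_ge0.
Qed.

End sequence_space.

Record lp (R : realType) (p : R) (p1 : 1 <= p) := Lp {
  lp_val :> int -> R[i];
  lp_valP : lp_val \in lp_pred p }.

Section lp_normedModType.
Context {R : realType} (p : R) (p1 : 1 <= p).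

HB.instance Definition _ := [isSub for @lp_val R p p1].
HB.instance Definition _ := [Choice of lp p1 by <:].
HB.instance Definition _ := GRing.isSubmodClosed.Build R[i] (int -> R[i])
  (lp_pred p) (lp_submod_closed p1).
HB.instance Definition _ := [SubChoice_isSubLmodule of lp p1 by <:].

Let p0 : 0 < p. Proof. exact: lt_le_trans p1. Qed.

Let realcD (a b : R) : a%:C + b%:C = (a + b)%:C :> R[i].
Proof. by apply/eqP; rewrite eq_complex /= addr0 !eqxx. Qed.

Let realcM (a b : R) : a%:C * b%:C = (a * b)%:C :> R[i].
Proof. by apply/eqP; rewrite eq_complex /= !mul0r mulr0 subr0 addr0 !eqxx. Qed.

Let norm (x : lp p1) : R[i] := (lp_norm p x)%:C.

Let normD x y : norm (x + y) <= norm x + norm y.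
Proof.
rewrite /norm realcD lecR.
exact: lp_normD p1 (lp_valP x) (lp_valP y).
Qed.

Let normZ (a : R[i]) x : norm (a *: x) = `|a| * norm x.
Proof.
have -> : `|a| = (normc a)%:C by case: a.
rewrite /norm realcM.
have -> : lp_val (a *: x) = a *: lp_val x by [].
by rewrite lp_normZ ?lp_valP.
Qed.

Let norm_eq0 x : norm x = 0 -> x = 0.
Proof.
by case=> /lp_norm_eq0 x0; apply/val_inj/x0 => //; exact: lp_valP.
Qed.

HB.instance Definition _ := Lmodule_isNormed.Build R[i] (lp p1) normD normZ norm_eq0.

Lemma lp_normrE (x : lp p1) : `|x| = (lp_norm p x)%:C.
Proof. by []. Qed.

End lp_normedModType.

Section lp_basis.
Context {R : realType} (p : R) (p1 : 1 <= p).

Let basis_pred (n : int) : (fun m : int => (m == n)%:R : R[i]) \in lp_pred p.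
Proof.
have p0 : 0 < p by exact: lt_le_trans p1.
rewrite lp_predE /lp_esum.
rewrite (eq_esum (b := fun m => if m \in [set n] then 1%E else 0%E)) => [|m _].
  by rewrite -(esum_mkcond [set n]) esum_set1// ltry.
have -> : (m \in [set n]) = (m == n) by apply/idP/eqP; rewrite inE.
case: eqP => _; first by rewrite (@normc1 R) powR1.
by rewrite (@normc0 R) powR0 ?gt_eqF.
Qed.

Definition lp_e (n : int) : lp p1 := Lp p1 (basis_pred n).

End lp_basis.

(* E^* as a set of functions, so that the pointwise operations of V -> R[i]^o
   apply; x z stands for the duality <z, x>, which is C-bilinear. *)
Definition dual (R : realType) (V : normedModType R[i]) : set (V -> R[i]^o) :=
  [set f : V -> R[i]^o | linear f /\ continuous f].
Arguments dual {R} V.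

Definition dual_norm (R : realType) (V : normedModType R[i])
    (f : V -> R[i]^o) : R :=
  sup [set normc (f z) | z in [set z : V | `|z| <= 1]].

Definition adjoint (R : realType) (V : normedModType R[i]) (T : V -> V)
  (f : V -> R[i]^o) : V -> R[i]^o := f \o T.

Lemma adjoint_dual (R : realType) (V : normedModType R[i])
    (T : {linear V -> V}) (f : V -> R[i]^o) :
  bounded_near T (nbhs (0 : V)) -> dual V f -> dual V (adjoint T f).
Proof.
move=> /linear_bounded_continuous cT [lf cf]; split => [a x y|x].
  by rewrite /adjoint /= linearP lf.
by apply: continuous_comp; [exact: cT|exact: cf].
Qed.

Notation borel V := (g_sigma_algebraType (@open V)).

Section complex_valued.
Context {R : realType}.

Definition expi (t : R) : R[i] := cos t +i* sin t.

(* the principal logarithm, with imaginary part in ]-pi, pi] *)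
Definition carg (z : R[i]) : R :=
  if 0 <= Im z then acos (Re z / normc z) else - acos (Re z / normc z).

Definition clog (z : R[i]) : R[i] := ln (normc z) +i* carg z.

Lemma clog_expR (t : R) : clog (expR t)%:C = t%:C.
Proof.
rewrite /clog /carg /= lexx expr0n /= addr0 sqrtr_sqr gtr0_norm ?expR_gt0//.
by rewrite expRK divff ?gt_eqF ?expR_gt0// acos1.
Qed.

Definition cintegral d (T : measurableType d) (mu : {measure set T -> \bar R})
    (f : T -> R[i]) : R[i] :=
  (\int[mu]_z Re (f z)) +i* (\int[mu]_z Im (f z)).

End complex_valued.

Section measures_on_normed_spaces.
Context {R : realType} {V : normedModType R[i]}.
Context (mu : {measure set (borel V) -> \bar R}).
Implicit Types (x y : V -> R[i]^o) (T : V -> V).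

Definition charfun x : R[i] := cintegral mu (fun z => expi (Re (x z))).

(* The logarithms below are those of characteristic functionals; when these are
   exponentials of stable_exponent, the principal logarithm returns that
   exponent: see codiff_eqE and codiff_neqE. *)
Definition codiff_eq x y : R[i] :=
  clog (cintegral mu (fun z => expi (Re ((x - y) z))))
  - clog (cintegral mu (fun z => expi (Re (x z))))
  - clog (cintegral mu (fun z => expi (- Re (y z)))).

Definition codiff_neq x y : R[i] :=
  clog (cintegral mu (fun z => expi (Re (x z) - Im (y z))))
  - clog (cintegral mu (fun z => expi (Re (x z))))
  - clog (cintegral mu (fun z => expi (- Im (y z)))).

Definition stable_exponent (alpha : R) (xi : {measure set (borel V) -> \bar R})
    x : R :=
  - \int[xi]_z (`|Re (x z)| `^ alpha).

Definition has_stable_charfun (alpha : R)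
    (xi : {measure set (borel V) -> \bar R}) :=
  forall x, dual V x -> charfun x = (expR (stable_exponent alpha xi x))%:C.

Definition invariant_measure T := forall A : set (borel V),
  measurable A -> mu (T @^-1` A) = mu A.

Definition mixing_measure T := forall A B : set (borel V),
  measurable A -> measurable B ->
  (fun n => mu (A `&` (iter n T @^-1` B))) @ \oo --> (mu A * mu B)%E.

End measures_on_normed_spaces.

Section codiff_exponent.
Context {R : realType} {V : normedModType R[i]}.
Context (mu xi : {measure set (borel V) -> \bar R}) (alpha : R).
Context (mu_xi : has_stable_charfun mu alpha xi).
Local Notation psi := (stable_exponent alpha xi).

Let clog_psi x (g : V -> R) : dual V x -> (forall z, g z = Re (x z)) ->
  clog (cintegral mu (fun z => expi (g z))) = (psi x)%:C.
Proof.
move=> dx /funext ->; rewrite -[cintegral _ _]/(charfun mu x).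
by rewrite mu_xi// clog_expR.
Qed.

Let dualZD (a : R[i]) x y : dual V x -> dual V y -> dual V (a *: x + y).
Proof.
move=> [lx cx] [ly cy]; split.
- by move=> b u v /=; rewrite !fctE lx ly !scalerDr !scalerA (mulrC b) addrACA.
- move=> z; apply: cvgD; last exact: cy.
  by apply: cvgZr; exact: cx.
Qed.

Let dual0 : dual V 0.
Proof. by split=> [b u v|]; [rewrite scaler0 addr0|exact: cst_continuous]. Qed.

Lemma codiff_eqE x y : dual V x -> dual V y ->
  codiff_eq mu x y = (psi (x - y) - psi x - psi (- y))%:C.
Proof.
move=> dx dy.
have dNy : dual V (- y) by rewrite -scaleN1r -[_ *: _]addr0; exact: dualZD.
have dxy : dual V (x - y) by rewrite -[x]scale1r; exact: dualZD.
rewrite /codiff_eq (clog_psi dxy)// (clog_psi dx)// (clog_psi dNy).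
  by rewrite !rmorphB.
by move=> z; rewrite fctE; case: (y z).
Qed.

Lemma codiff_neqE x y : dual V x -> dual V y ->
  codiff_neq mu x y = (psi (x + 'i%C *: y) - psi x - psi ('i%C *: y))%:C.
Proof.
move=> dx dy.
have diy : dual V ('i%C *: y) by rewrite -[_ *: _]addr0; exact: dualZD.
have dxy : dual V (x + 'i%C *: y) by rewrite addrC; exact: dualZD.
have ReiE z : Re (('i%C *: y) z) = - Im (y z).
  by rewrite fctE; case: (y z) => a b /=; rewrite mul0r mul1r sub0r.
rewrite /codiff_neq (clog_psi dxy) => [|z].
  by rewrite (clog_psi dx)// (clog_psi diy)// !rmorphB.
by rewrite -ReiE fctE; case: (x z) => a b; case: (_ z) => c d.
Qed.

End codiff_exponent.

Section weighted_shift.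
Context {R : realType}.
Implicit Types (alpha : R) (w k : int -> R).

(* for n = Negz m = - (m + 1), the index l ranges over n + 1 = - m, ..., 0 *)
Definition kseq (k0 : R) w (n : int) : R :=
  match n with
  | Posz m => k0 * \prod_(1 <= l < m.+1) w l%:Z
  | Negz m => k0 * \prod_(0 <= j < m.+1) (w (- j%:Z))^-1
  end.

Definition in_lalpha alpha k :=
  summable [set: int] (fun n => (`|k n| `^ alpha)%:E).

Section control_measure.
Context (p : R) (p1 : 1 <= p) (alpha : R) (k : int -> R).
Local Notation E := (lp p1).

Definition atoms (n : int) : {measure set (borel E) -> \bar R} :=
  mscale (NngNum (powR_ge0 (k n) alpha))
    (measure_add (dirac (lp_e p1 n : borel E))
      (dirac ('i%C *: lp_e p1 n : borel E))).

(* the sum over n in Z groups the terms n = m and n = - (m + 1) *)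
Definition control_measure : {measure set (borel E) -> \bar R} :=
  mscale (2^-1)%:nng
    (mseries (fun m : nat => measure_add (atoms (Posz m)) (atoms (Negz m))) 0).

End control_measure.
End weighted_shift.

Definition bigO_nat (R : realType) (f : nat -> \bar R) (g : nat -> R) :=
  exists2 C : R, 0 < C & forall n, (`|f n| <= (C * `|g n|)%:E)%E.

Definition codiff_sup (R : realType) (V : normedModType R[i])
    (C : (V -> R[i]^o) -> (V -> R[i]^o) -> R[i]) (T : V -> V) (alpha : R)
    (n : nat) : \bar R :=
  ereal_sup [set (normc (C x (iter n (adjoint T) y)) /
      (dual_norm x `^ (alpha / 2) * dual_norm y `^ (alpha / 2)))%:E
    | x in dual V `\ 0 & y in dual V `\ 0].

(* Main.v *)
Require Import Defs.
From HB Require Import structures.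
From mathcomp Require Import all_boot all_order all_algebra.
From mathcomp Require Import all_classical all_reals all_analysis.
From mathcomp Require Import measurable_realfun ring lra zify.
Import Order.TTheory GRing.Theory Num.Theory.
Import numFieldNormedType.Exports.
From mathcomp Require Import complex.
Import ComplexField.Normc.

(** Write x_n for the value at e_n of a continuous functional x. Every atom of
    the control measure sits on some e_n or i e_n, so the exponent of mu at x
    is minus half the sum over n of k_n^alpha (|Re x_n|^alpha + |Im x_n|^alpha).
    The weights k are made for the identity k_n w_(n+1) = k_(n+1), and with it
    composing x with T only translates this sum: x and x o T have the same
    exponent ([stable_exponent_adjoint]).

    To pass from exponents to measures, trigonometric functions cos (Re x + a)
    are closed under products up to linear combinations, and the smallest
    vector space of functions that contains them and is stable under bounded
    pointwise limits contains the indicators of all Borel sets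
    ([blc_trig_borel]). Its engine is a multiplicative monotone class theorem
    ([blc_indic_sigma]); separability of l^p then identifies the Borel sets
    with those generated by half-spaces ([borel_half_spaces]). Properties that
    are linear and stable under bounded limits thus extend from trigonometric
    functions to Borel sets: equality of the integrals of f and f o T gives
    invariance, and convergence of the integral of f (g o T^n) to the product
    of the integrals, extended in one argument after the other, gives mixing
    ([blc_preserving], [blc_decorrelates]).

    For the codifferences, | |a + b|^alpha - |a|^alpha - |b|^alpha | is at most
    4 |a|^(alpha/2) |b|^(alpha/2) ([norm_powR_defect]), so that the codifference
    of x and y o T^n is at most
      4 |x|^(alpha/2) |y|^(alpha/2) sum_m (k_m k_(m+n))^(alpha/2),
    a correlation of the single sequence k_m^(alpha/2) with its n-th translate.
    This sequence decays at least like etam^(alpha/2) per step on the left and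
    like etap^(alpha/2) on the right. As alpha < p, the rate
    eta = max (etam^(2 alpha/p - 1), etap) strictly exceeds etam, and this gap is
    what makes the correlation O(eta^(alpha n/2)) without a linear factor in n
    ([esum_shift_product_le]). When p < 2 alpha the rate is less than 1, the
    exponent at x + y o T^n tends to the sum of the exponents, and mixing
    follows. *)

Local Open Scope classical_set_scope.
Local Open Scope complex_scope.
Local Open Scope ring_scope.

Set Implicit Arguments.
Unset Strict Implicit.

(** * Polynomial approximation of a threshold *)

Section power_steps.
Context {R : realType}.
Implicit Types s r x : R.

Lemma bernoulli_ge x n : -1 <= x -> 1 + x *+ n <= (1 + x) ^+ n.
Proof.
move=> x1; elim: n => [|n ih]; first by rewrite mulr0n addr0 expr0.
rewrite exprS; have x10 : 0 <= 1 + x by lra.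
apply: le_trans (ler_wpM2l x10 ih).
have : 0 <= x * (x *+ n) by rewrite mulrnAr mulrn_wge0// sqr_ge0.
rewrite mulrSr; lra.
Qed.

Lemma cvg_mulrn_expr r : 0 <= r -> r < 1 -> (r ^+ n *+ n) @[n --> \oo] --> 0.
Proof.
move=> r0 r1; have [->|rn0] := eqVneq r 0.
  apply: cvg_near_cst; near=> n.
  by rewrite expr0n gtn_eqF ?mul0rn//; near: n; exact: nbhs_infty_gt.
pose q := Num.sqrt r.
have rp : 0 < r by rewrite lt_neqAle eq_sym rn0.
have qp : 0 < q by rewrite sqrtr_gt0.
have q1 : q < 1 by rewrite -sqrtr1 ltr_sqrt.
have rE : r = q * q by rewrite -expr2 sqr_sqrtr.
pose h := q^-1 - 1.
have hp : 0 < h by rewrite subr_gt0 invf_gt1.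
(* n q^n is at most 1/h by Bernoulli's inequality, and r^n = q^n q^n *)
have bnd n : 0 <= r ^+ n *+ n <= h^-1 * q ^+ n.
  rewrite mulrn_wge0 ?exprn_ge0//= rE exprMn -mulrnAr mulrC.
  rewrite ler_wpM2r ?exprn_ge0 ?(ltW qp)//.
  have hn : h *+ n <= q ^- n.
    rewrite -exprVn (_ : q^-1 = 1 + h); last by rewrite /h; lra.
    have := @bernoulli_ge h n; lra.
  rewrite -[leRHS]div1r ler_pdivlMr// mulrnAl -mulrnAr mulrC.
  rewrite -ler_pdivlMr ?exprn_gt0// div1r.
  exact: hn.
apply: (@squeeze_cvgr _ \oo _ R (cst 0) (fun n => h^-1 * q ^+ n)).
- by near=> n; exact: bnd.
- exact: cvg_cst.
rewrite -[X in _ --> X](mulr0 h^-1); apply: cvgMr.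
by apply: cvg_expr; rewrite gtr0_norm.
Unshelve. all: by end_near.
Qed.

(** By Bernoulli's inequality this polynomial in s lies between
    1 - k (2 s)^k and 1 / (1 + k (2 s)^k). Below 1/2 the term k (2 s)^k tends to
    0, from 1/2 on it is at least k; the factor k in the exponent 2^k k is
    there for the point s = 1/2. *)
Lemma cvg_threshold s : 0 <= s <= 1 ->
  ((1 - s ^+ k) ^+ (2 ^ k * k)) @[k --> \oo] --> ((s < 1 / 2)%R%:R : R).
Proof.
move=> /andP[s0 s1].
have sk k : 0 <= s ^+ k <= 1 by rewrite exprn_ge0// exprn_ile1.
have corr k : s ^+ k *+ (2 ^ k * k) = (2 * s) ^+ k *+ k.
  by rewrite mulrnA exprMn -natrX mulr_natl.
have ub k : (1 - s ^+ k) ^+ (2 ^ k * k) <= 1.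
  by have /andP[? ?] := sk k; rewrite exprn_ile1; lra.
case: (ltP s (1 / 2)) => hs /=.
  apply: (@squeeze_cvgr _ \oo _ R (fun k => 1 - (2 * s) ^+ k *+ k) (cst 1)).
  - near=> k; rewrite ub andbT.
    have := @bernoulli_ge (- s ^+ k) (2 ^ k * k).
    by rewrite mulNrn corr; apply; have /andP[? ?] := sk k; lra.
  - rewrite -[X in _ --> X]subr0; apply: cvgB; first exact: cvg_cst.
    by apply: cvg_mulrn_expr; lra.
  - exact: cvg_cst.
apply: (@squeeze_cvgr _ \oo _ R (cst 0) (@harmonic R)).
- near=> k; have /andP[sk0 sk1] := sk k.
  rewrite exprn_ge0 ?subr_ge0//=.
  have h1 : k.+1%:R <= (1 + s ^+ k) ^+ (2 ^ k * k).
    apply: le_trans (@bernoulli_ge (s ^+ k) (2 ^ k * k) _); last by lra.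
    rewrite corr -natr1 addrC lerD2l; apply: ler_wMn2r.
    by rewrite exprn_ege1//; lra.
  rewrite /harmonic /= -div1r ler_pdivlMr//.
  apply: le_trans (ler_wpM2l _ h1) _; first by rewrite exprn_ge0// subr_ge0.
  rewrite -exprMn -subr_sqr expr1n exprn_ile1 ?subr_ge0//.
    by rewrite exprn_ile1.
  by rewrite lerBlDr lerDl exprn_ge0.
- exact: cvg_cst.
- exact: cvg_harmonic.
Unshelve. all: by end_near.
Qed.

End power_steps.

(** * Functions generated by bounded pointwise limits *)

Section bounded_limit_closure.
Context {R : realType} {X : Type}.
Implicit Types (K : set (X -> R)) (f g : X -> R).

(** The bounded-limit closure of K. Being an inductive predicate, it comes with
    the induction principle by which a linear property that is stable under
    bounded limits extends from K. *)
Inductive blc K : set (X -> R) :=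
| blc_base f : K f -> blc K f
| blc_lin a f g : blc K f -> blc K g -> blc K (fun x => a * f x + g x)
| blc_lim (u : nat -> X -> R) f M : (forall n, blc K (u n)) ->
    (forall n x, `|u n x| <= M) ->
    (forall x, u n x @[n --> \oo] --> f x) -> blc K f.

Variable K : set (X -> R).
Hypothesis K1 : K (cst 1).
Hypothesis Kbnd : forall f, K f -> exists M, forall x, `|f x| <= M.
Hypothesis KM : forall f g, K f -> K g -> blc K (fun x => f x * g x).

Lemma blc_bounded f : blc K f -> exists M, forall x, `|f x| <= M.
Proof.
elim=> {f} [f /Kbnd//|a f g _ [M fM] _ [N gN]|u f M _ _ uM uf].
  exists (`|a| * M + N) => x; apply: le_trans (ler_normD _ _) _.
  by rewrite normrM lerD// ler_wpM2l.
exists M => x; apply: (cvgr_to_le (cvg_norm (uf x))).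
by near=> n; exact: uM.
Unshelve. all: by end_near.
Qed.

Let blc_mul_lim f u g M : (exists N, forall x, `|f x| <= N) ->
  (forall n, blc K (fun x => f x * u n x)) -> (forall n x, `|u n x| <= M) ->
  (forall x, u n x @[n --> \oo] --> g x) -> blc K (fun x => f x * g x).
Proof.
move=> [N fN] fu uM ug; apply: (@blc_lim _ _ _ (N * M) fu) => [n x|x].
  by rewrite normrM ler_pM.
by apply: cvgMr; exact: ug.
Qed.

(** For a fixed factor, the other factors that stay in the closure form a class
    of the same kind; the two inductions use this first with a factor in K, then
    with a factor in the closure. *)
Lemma blcM f g : blc K f -> blc K g -> blc K (fun x => f x * g x).
Proof.
move=> Kf Kg.
have base h : K h -> blc K (fun x => h x * g x).
  move=> Kh; elim: Kg => {g} [g Kg|a g1 g2 _ ih1 _ ih2|u g M _ ih uM ug].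
  - exact: KM.
  - rewrite [X in blc _ X](_ : _ = fun x => a * (h x * g1 x) + h x * g2 x).
      exact: blc_lin.
    by apply/funext => x; ring.
  - exact: blc_mul_lim (Kbnd Kh) ih uM ug.
elim: Kf => {f} [f /base//|a f1 f2 _ ih1 _ ih2|u f M Ku ih uM uf].
  rewrite [X in blc _ X](_ : _ = fun x => a * (f1 x * g x) + f2 x * g x).
    exact: blc_lin.
  by apply/funext => x; ring.
rewrite [X in blc _ X](_ : _ = fun x => g x * f x); last first.
  by apply/funext => x; rewrite mulrC.
apply: (blc_mul_lim (blc_bounded Kg)) uM uf => n.
rewrite [X in blc _ X](_ : _ = fun x => u n x * g x)//.
by apply/funext => x; rewrite mulrC.
Qed.

Lemma blc1 : blc K (cst 1). Proof. exact: blc_base. Qed.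

Lemma blcB1 f : blc K f -> blc K (fun x => 1 - f x).
Proof.
move=> Kf; have := blc_lin (-1) Kf blc1.
by congr blc; apply/funext => x /=; ring.
Qed.

Lemma blcX f n : blc K f -> blc K (fun x => f x ^+ n).
Proof.
move=> Kf; elim: n => [|n ih].
  by have := blc1; congr blc; apply/funext => x; rewrite expr0.
by have := blcM Kf ih; congr blc; apply/funext => x; rewrite exprS.
Qed.

(** After an affine change of scale, f becomes a function with values in [0, 1]
    and its positivity set the set below the threshold 1/2. *)
Lemma blc_indic_gt0 f : blc K f -> blc K \1_[set x | 0 < f x].
Proof.
move=> Kf; have [M fM] := blc_bounded Kf.
pose N := `|M| + 1; have N0 : 0 < N by rewrite /N; have := normr_ge0 M; lra.
have fN x : `|f x| <= N.
  by apply: le_trans (fM x) _; rewrite /N; have := ler_norm M; lra.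
pose s x : R := 1 / 2 - f x / N / 2.
have s01 x : 0 <= s x <= 1.
  have : `|f x / N| <= 1.
    by rewrite normrM (gtr0_norm (_ : 0 < N^-1)) ?invr_gt0// ler_pdivrMr// mul1r.
  by rewrite ler_norml /s => /andP[? ?]; lra.
have Ks : blc K s.
  have := blc_lin (- (N^-1 / 2)) Kf (blc_lin (- (1 / 2)) blc1 blc1).
  by congr blc; apply/funext => x; rewrite /s /=; field; rewrite gt_eqF.
apply: (@blc_lim _ (fun k x => (1 - s x ^+ k) ^+ (2 ^ k * k)) _ 1).
- by move=> k; apply: blcX; apply: blcB1; exact: blcX.
- move=> k x; have /andP[s0 s1] := s01 x.
  have h0 : 0 <= 1 - s x ^+ k by rewrite subr_ge0 exprn_ile1.
  by rewrite ger0_norm ?exprn_ge0// exprn_ile1// lerBlDr lerDl exprn_ge0.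
- move=> x; have := cvg_threshold (s01 x); rewrite indicE.
  suff -> : (s x < 1 / 2) = (x \in [set x | 0 < f x]) by [].
  apply/idP/idP; rewrite inE /= /s.
    by move=> h; rewrite -(pmulr_lgt0 _ (_ : 0 < N^-1)) ?invr_gt0//; lra.
  by move=> h; have := divr_gt0 h N0; lra.
Qed.

Lemma blc_indicC A : blc K \1_A -> blc K \1_(~` A).
Proof.
move=> KA; have := blcB1 KA; congr blc; apply/funext => x.
by rewrite !indicE in_setC; case: (x \in A); rewrite /= (subrr, subr0).
Qed.

Lemma blc_indicI A B : blc K \1_A -> blc K \1_B -> blc K \1_(A `&` B).
Proof. by move=> KA KB; rewrite indicI; exact: (blcM KA KB). Qed.

Lemma blc_indic_sigma_algebra : sigma_algebra setT [set A | blc K \1_A].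
Proof.
have K0 : blc K \1_set0.
  have := blcB1 blc1; congr blc; apply/funext => x /=.
  by rewrite indicE in_set0 subrr.
split => //=; first by move=> A; rewrite setTD; exact: blc_indicC.
move=> F KF; pose G n := \big[setU/set0]_(i < n) F i.
have KG n : blc K \1_(G n).
  rewrite /G; elim: n => [|n ih]; first by rewrite big_ord0.
  rewrite big_ord_recr/= -[X in \1_X]setCK setCU.
  by apply: blc_indicC; apply: blc_indicI; exact: blc_indicC.
apply: (blc_lim (M := 1) KG) => [n x|x].
  by rewrite indicE; case: (_ \in _); rewrite ?normr1 ?normr0.
have [[m _ Fm]|nF] := pselect ((\bigcup_n F n) x).
  apply: cvg_near_cst; near=> n.
  have mn : (m < n)%N by near: n; exact: nbhs_infty_gt.
  rewrite !indicE !mem_set//; first by exists m.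
  by rewrite /G -bigcup_mkord; exists m.
apply: cvg_near_cst; near=> n.
rewrite !indicE !memNset//.
by rewrite /G -bigcup_mkord => -[m _ Fm]; apply: nF; exists m.
Unshelve. all: by end_near.
Qed.

(** A multiplicative form of the monotone class theorem: indicators turn the
    operations of a sigma-algebra into differences, products and bounded limits,
    so the sets whose indicators lie in the closure form a sigma-algebra. *)
Lemma blc_indic_sigma (G : set (set X)) A :
  (forall B, G B -> blc K \1_B) -> <<s G >> A -> blc K \1_A.
Proof. by move=> KG; exact: smallest_sub blc_indic_sigma_algebra KG A. Qed.

End bounded_limit_closure.

(** * The additivity defect of a power *)

Section power_inequality.
Context {R : realType}.
Implicit Types alpha a b s t : R.

(** On [0, 2] the power s^alpha lies between 1 and s^2, which are at distance
    |s - 1| (s + 1). *)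
Lemma norm_powR_sub1 alpha s : 0 < alpha -> alpha <= 2 -> 0 <= s -> s <= 2 ->
  `|s `^ alpha - 1| <= 3 * `|s - 1|.
Proof.
move=> a0 a2 s0 s2; have p1 : (1 : R) `^ alpha = 1 by rewrite powR1.
have [s1|s1] := leP s 1.
  have h1 : s `^ alpha <= 1.
    by rewrite -p1; apply: ge0_ler_powR; rewrite ?nnegrE//; exact: ltW.
  have h2 : s ^+ 2 <= s `^ alpha.
    have [->|sn0] := eqVneq s 0; first by rewrite expr0n powR_ge0.
    rewrite -powR_mulrn//; apply: ger_powR => //.
    by rewrite lt_neqAle eq_sym sn0 s0.
  rewrite ler0_norm ?subr_le0// ler0_norm ?subr_le0//.
  have : 0 <= (1 - s) * (2 - s) by rewrite mulr_ge0//; lra.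
  have -> : (1 - s) * (2 - s) = s ^+ 2 - 3 * s + 2 by ring.
  lra.
have h1 : 1 <= s `^ alpha.
  by rewrite -p1; apply: ge0_ler_powR; rewrite ?nnegrE//; exact: ltW.
have h2 : s `^ alpha <= s ^+ 2.
  by rewrite -powR_mulrn//; apply: ler_powR => //; exact: ltW.
rewrite ger0_norm ?subr_ge0// ger0_norm ?subr_ge0 ?(ltW s1)//.
have : 0 <= (s - 1) * (2 - s) by rewrite mulr_ge0//; lra.
have -> : (s - 1) * (2 - s) = 3 * s - 2 - s ^+ 2 by ring.
lra.
Qed.

(** By homogeneity only t = b / a with |t| <= 1 matters, and there both
    |(1 + t)^alpha - 1| = O(|t|) and |t|^alpha are O(|t|^(alpha/2)). *)
Lemma norm_powR_defect alpha a b : 0 < alpha -> alpha <= 2 ->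
  `| `|a + b| `^ alpha - `|a| `^ alpha - `|b| `^ alpha|
    <= 4 * (`|a| `^ (alpha / 2) * `|b| `^ (alpha / 2)).
Proof.
move=> a0 a2.
wlog ba : a b / `|b| <= `|a|.
  move=> H; have [|/ltW] := leP `|b| `|a|; first exact: H.
  move=> /H; rewrite (addrC b) (mulrC (`|b| `^ _)).
  by rewrite (_ : forall x y z : R, x - y - z = x - z - y)// => x y z; ring.
have [az|an0] := eqVneq a 0.
  have -> : b = 0 by apply/normr0_eq0/eqP; rewrite eq_le normr_ge0 (le_trans ba)// az normr0.
  by rewrite az addr0 normr0 !powR0 ?gt_eqF ?divr_gt0// subrr subr0 normr0 !mulr0.
pose t := b / a; have bE : b = t * a by rewrite /t divfK.
have na0 : 0 < `|a| by rewrite normr_gt0.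
have t1 : `|t| <= 1 by rewrite normrM normfV ler_pdivrMr// mul1r.
clearbody t; have st : `|1 + t| = 1 + t by move: t1; rewrite ler_norml => /andP[? ?]; rewrite ger0_norm//; lra.
have -> : a + b = (1 + t) * a by rewrite bE; ring.
rewrite bE !normrM !powRM// st.
set A := `|a| `^ alpha; set h := `|a| `^ (alpha / 2).
have AE : A = h * h.
  by rewrite /A /h -powRD -?splitr// normr_eq0 an0 implybT.
have A0 : 0 <= A by exact: powR_ge0.
clearbody A h.
have factor (x y : R) : x * A - A - y * A = (x - 1 - y) * A by ring.
rewrite factor.
rewrite normrM [X in _ * X]ger0_norm//.
rewrite [leRHS](_ : _ = 4 * `|t| `^ (alpha / 2) * A); last by rewrite AE; ring.
apply: ler_wpM2r => //.
apply: le_trans (ler_normB _ _) _; rewrite [X in _ + X]ger0_norm ?powR_ge0//.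
have ht : `|t| <= `|t| `^ (alpha / 2).
  have [->|tn0] := eqVneq t 0; first by rewrite normr0 powR_ge0.
  by apply: ger1_powR; rewrite ?normr_gt0 ?tn0//; lra.
have ht2 : `|t| `^ alpha <= `|t| `^ (alpha / 2).
  have [->|tn0] := eqVneq t 0; first by rewrite normr0 !powR0 ?gt_eqF// divr_gt0.
  by apply: ger_powR; rewrite ?normr_gt0 ?tn0//; lra.
have : `|(1 + t) `^ alpha - 1| <= 3 * `|1 + t - 1|.
  by apply: norm_powR_sub1 => //; move: t1; rewrite ler_norml; lra.
rewrite (_ : 1 + t - 1 = t); last by ring.
lra.
Qed.

End power_inequality.

(** * Correlations of a sequence with its translates *)

Section shift_products.
Context {R : realType}.
Local Open Scope ereal_scope.

Lemma esumZl_le (T : choiceType) (D : set T) (c : R) (f : T -> \bar R) : (0 <= c)%R ->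
  (forall i, 0 <= f i) -> \esum_(i in D) (c%:E * f i) <= c%:E * \esum_(i in D) f i.
Proof.
move=> c0 f0; apply: ub_ereal_sup => _ [X XD <-].
rewrite -ge0_mule_fsumr//; apply: lee_wpmul2l; first by rewrite lee_fin.
by apply: esum_ge; exists X.
Qed.

Lemma esum_half_geometric_lty (Q : int) (c r : R) : (0 <= c)%R -> (0 <= r)%R -> (r < 1)%R ->
  \esum_(m in [set: int]) (if (m <= Q)%R then (c * r ^+ `|Q - m|%N)%:E else 0) < +oo.
Proof.
move=> c0 r0 r1; pose e (j : nat) : int := (Q - j%:Z)%R.
have eb : set_bij [set: nat] [set m : int | (m <= Q)%R] e.
  split=> [j _|i j _ _|m /= mQ]; rewrite /e.
  - by rewrite /=; lia.
  - by move=> ij; lia.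
  - by exists `|Q - m|%N => //; lia.
rewrite (eq_esum (b := fun m => if m \in [set m : int | (m <= Q)%R]
  then (c * r ^+ `|Q - m|%N)%:E else 0)); last by move=> m _; rewrite mem_setE.
rewrite -esum_mkcond (reindex_esum _ _ _ _ eb) -nneseries_esumT; last first.
  by move=> n; rewrite lee_fin mulr_ge0// exprn_ge0.
under eq_eseriesr => n _.
  have -> : `|Q - e n|%N = n by rewrite /e; lia.
  over.
have r1' : (`|r| < 1)%R by rewrite ger0_norm.
have -> : \sum_(n <oo) (c * r ^+ n)%:E = (c / (1 - r))%:E; last exact: ltry.
apply/cvg_lim => //.
have -> : (fun n => \sum_(0 <= i < n) (c * r ^+ i)%:E) = EFin \o series (geometric c r).
  by apply/funext => n; rewrite sumEFin.
apply: cvg_EFin; first by near=> n.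
exact: cvg_geometric_series.
Unshelve. all: by end_near.
Qed.

(** If kap is dominated by a sequence v that a step to the right multiplies by at
    most rho, then kap m * kap (m + n) is at most rho^n * (kap m * v m). To the
    left of Q take v geometric of ratio rho: kap v is summable there, as kap
    decays with the smaller ratio a. *)
Lemma esum_shift_product_le (kap : int -> R) (a rho : R) (Q : nat) :
  (forall m, 0 <= kap m)%R -> \esum_(m in [set: int]) (kap m * kap m)%:E < +oo ->
  (0 < a)%R -> (a < rho)%R -> (a * rho <= 1)%R ->
  (forall m : int, Q%:Z <= m -> kap (m + 1) <= rho * kap m)%R ->
  (forall m : int, m <= - Q%:Z -> kap (m - 1) <= a * kap m)%R ->
  exists2 C : R, (0 < C)%R & forall n : nat,
    \esum_(m in [set: int]) (kap m * kap (m + n%:Z))%:E <= (C * rho ^+ n)%:E.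
Proof.
move=> k0 ksum a0 arho arho1 kr kl.
have rho0 : (0 < rho)%R by exact: lt_trans arho.
(* D bounds kap (Q - j) / a^j, which is nonincreasing from j = 2 Q on *)
pose g j : R := (kap (Q%:Z - j%:Z) / a ^+ j)%R.
have g0 j : (0 <= g j)%R by rewrite divr_ge0// exprn_ge0 ?ltW.
pose D : R := (\sum_(j < (2 * Q).+1) g j)%R.
have D0 : (0 <= D)%R by rewrite sumr_ge0.
have gD j : (g j <= D)%R.
  elim: j => [|j ih].
    by rewrite /D (bigD1 ord0)//= lerDl sumr_ge0.
  have [jQ|jQ] := ltnP j (2 * Q).
    have jQ' : (j.+1 < (2 * Q).+1)%N by [].
    by rewrite /D (bigD1 (Ordinal jQ'))//= lerDl sumr_ge0.
  apply: le_trans ih; rewrite /g.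
  have -> : (Q%:Z - j.+1%:Z = (Q%:Z - j%:Z) - 1)%R by lia.
  rewrite exprS invfM mulrA; apply: ler_wpM2r.
    by rewrite invr_ge0 exprn_ge0// ltW.
  by rewrite ler_pdivrMr// mulrC; apply: kl; lia.
have kD j : (kap (Q%:Z - j%:Z) <= D * a ^+ j)%R.
  by rewrite -ler_pdivrMr ?exprn_gt0//; exact: gD.
(* dominates kap, and a step to the right multiplies it by at most rho *)
pose v (m : int) : R := if (Q%:Z <= m)%R then kap m else (D * (rho^-1) ^+ `|(Q%:Z - m)%R|%N)%R.
have v0 m : (0 <= v m)%R.
  by rewrite /v; case: ifP => // _; rewrite mulr_ge0// exprn_ge0// invr_ge0 ltW.
have kv m : (kap m <= v m)%R.
  rewrite /v; case: ifPn => // mQ; have := kD `|(Q%:Z - m)%R|%N.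
  have -> : (Q%:Z - `|(Q%:Z - m)%R|%N%:Z = m)%R by lia.
  move=> /le_trans; apply; apply: ler_wpM2l => //.
  apply: lerXn2r; rewrite ?nnegrE ?invr_ge0 ?(ltW a0) ?(ltW rho0)//.
  by rewrite -[leRHS]div1r ler_pdivlMr.
have vS (m : int) : (v (m + 1) <= rho * v m)%R.
  rewrite /v; case: ifPn => [mQ1|mQ1]; case: ifPn => [mQ|mQ].
  - exact: kr.
  - have -> : `|(Q%:Z - m)%R|%N = 1%N by lia.
    rewrite expr1 mulrCA mulfV ?gt_eqF// mulr1.
    have -> : (m + 1 = Q%:Z - 0%:Z)%R by lia.
    by have := kD 0%N; rewrite expr0 mulr1.
  - by lia.
  - have -> : `|(Q%:Z - m)%R|%N = `|(Q%:Z - (m + 1))%R|%N.+1 by lia.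
    by rewrite exprS mulrCA mulVKf ?gt_eqF.
have vn (m : int) n : (kap (m + n%:Z) <= rho ^+ n * v m)%R.
  apply: le_trans (kv _) _; elim: n => [|n ih].
    by rewrite addr0 expr0 mul1r.
  have -> : (m + n.+1%:Z = m + n%:Z + 1)%R by lia.
  apply: le_trans (vS _) _; rewrite exprS -mulrA; apply: ler_wpM2l => //.
  exact: ltW.
(* bounds kap v on the left, where kap decays like a^j and v grows like rho^-j *)
pose h (m : int) : \bar R := if (m <= Q%:Z)%R then (D * D * (a / rho) ^+ `|(Q%:Z - m)%R|%N)%:E else 0.
have h0 m : 0 <= h m.
  rewrite /h; case: ifP => // _; rewrite lee_fin mulr_ge0 ?mulr_ge0//.
  by rewrite exprn_ge0// divr_ge0// ltW.
have kvh (m : int) : (kap m * v m)%:E <= (kap m * kap m)%:E + h m.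
  rewrite /v; case: ifPn => mQ; first by rewrite leeDl.
  rewrite /h ifT; last by lia.
  apply: le_trans (_ : (D * D * (a / rho) ^+ `|(Q%:Z - m)%R|%N)%:E <= _); last first.
    by rewrite leeDr// lee_fin mulr_ge0.
  rewrite lee_fin exprMn.
  have := kD `|(Q%:Z - m)%R|%N.
  have -> : (Q%:Z - `|(Q%:Z - m)%R|%N%:Z = m)%R by lia.
  set A := (a ^+ _)%R; set B := (_ ^+ _)%R => kA.
  rewrite (_ : D * D * (A * B) = D * A * (D * B))%R; last by ring.
  by apply: ler_wpM2r => //; rewrite mulr_ge0// exprn_ge0// invr_ge0 ltW.
have Slty : \esum_(m in [set: int]) (kap m * v m)%:E < +oo.
  apply: le_lt_trans (le_esum (fun m _ => kvh m)) _.
  rewrite esumD//; last by move=> m _; rewrite lee_fin mulr_ge0.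
  rewrite lte_add_pinfty//; apply: esum_half_geometric_lty.
  - by rewrite mulr_ge0.
  - by rewrite divr_ge0 ?ltW.
  - by rewrite ltr_pdivrMr// mul1r.
set S := (\esum_(m in _) _) in Slty.
have S0 : 0 <= S by apply: esum_ge0 => m _; rewrite lee_fin mulr_ge0.
have Sfin : S \is a fin_num by rewrite ge0_fin_numE.
exists (fine S + 1)%R; first by rewrite ltr_wpDl// fine_ge0.
move=> n; apply: (@le_trans _ _ ((rho ^+ n)%:E * S)).
  apply: le_trans (esumZl_le _ _ _); last 2 first.
  - by rewrite exprn_ge0// ltW.
  - by move=> m; rewrite lee_fin mulr_ge0.
  apply: le_esum => m _; rewrite -EFinM lee_fin mulrCA.
  by apply: ler_wpM2l.
rewrite -(fineK Sfin) -EFinM lee_fin mulrC; apply: ler_wpM2r.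
  by rewrite exprn_ge0// ltW.
by rewrite lerDl.
Qed.
End shift_products.

(** * Continuous linear functionals *)

Section complex_norm.
Context {R : realType}.
Implicit Types z : R[i].

Lemma norm_normcE z : `|z| = (normc z)%:C. Proof. by case: z. Qed.

Lemma normc_ge0 z : 0 <= normc z.
Proof. by case: z => a b; exact: sqrtr_ge0. Qed.

Lemma norm_Re_le z : `|Re z| <= normc z.
Proof. by rewrite -lecR -norm_normcE; exact: normc_ge_Re. Qed.

Lemma norm_Im_le z : `|Im z| <= normc z.
Proof.
by case: z => a b /=; rewrite -sqrtr_sqr; apply: ler_wsqrtr; rewrite lerDr sqr_ge0.
Qed.

Lemma normc_le_ReIm z : normc z <= `|Re z| + `|Im z|.
Proof.
case: z => a b /=; rewrite -[leRHS]ger0_norm ?addr_ge0// -sqrtr_sqr.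
apply: ler_wsqrtr; rewrite sqrrD !real_normK ?num_real//.
rewrite -addrA lerD2l lerDr mulrn_wge0 ?mulr_ge0//.
Qed.

Lemma ReD (z1 z2 : R[i]) : Re (z1 + z2) = Re z1 + Re z2.
Proof. by case: z1 z2 => ? ? [? ?]. Qed.

Lemma Re_iM z : Re ('i%C * z) = - Im z.
Proof. by case: z => a b /=; rewrite mul0r mul1r sub0r. Qed.

Lemma Re_continuous : continuous (@Re R : R[i]^o -> R).
Proof.
move=> z; apply/(@cvgrPdist_lt _ _ _ (nbhs (z : R[i]^o))) => e e0.
exists e%:C; rewrite /= ?ltcR// => t /=.
rewrite norm_normcE ltcR; apply: le_lt_trans.
by rewrite (_ : Re z - Re t = Re (z - t)) ?norm_Re_le//; case: (z) (t) => ? ? [].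
Qed.

End complex_norm.

Section dual_functionals.
Context {R : realType} {V : normedModType R[i]}.
Implicit Types x y : V -> R[i]^o.

Lemma dualD x y : dual V x -> dual V y -> dual V (x + y).
Proof.
move=> [lx cx] [ly cy]; split; last by move=> z; apply: cvgD; [exact: cx|exact: cy].
by move=> b u v /=; rewrite !fctE lx ly !scalerDr addrACA.
Qed.

Lemma dualZ (a : R[i]) x : dual V x -> dual V (a *: x).
Proof.
move=> [lx cx]; split; last by move=> z; apply: cvgZl_tmp; exact: cx.
by move=> b u v /=; rewrite !fctE lx !scalerDr !scalerA (mulrC b).
Qed.

Lemma dualN x : dual V x -> dual V (- x).
Proof. by rewrite -scaleN1r; exact: dualZ. Qed.

Lemma dual0 : dual V 0.
Proof. by split=> [b u v|]; [rewrite scaler0 addr0|exact: cst_continuous]. Qed.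

Lemma dual_iter_adjoint (T : {linear V -> V}) x n :
  bounded_near T (nbhs (0 : V)) -> dual V x -> dual V (iter n (adjoint T) x).
Proof.
move=> bT dx; elim: n => [|n ih]; first exact: dx.
by rewrite iterS; exact: (adjoint_dual bT ih).
Qed.

Lemma iter_adjointE (T : V -> V) x n z : iter n (adjoint T) x z = x (iter n T z).
Proof. by elim: n z => //= n ih z; rewrite /adjoint /= ih -iterSr. Qed.

Lemma iter_adjointN (T : V -> V) x n : iter n (adjoint T) (- x) = - iter n (adjoint T) x.
Proof.
apply/funext => z; rewrite iter_adjointE.
by rewrite -[RHS]/(- iter n (adjoint T) x z) iter_adjointE.
Qed.

Lemma iter_adjointZ (T : V -> V) (a : R[i]) x n :
  iter n (adjoint T) (a *: x) = a *: iter n (adjoint T) x.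
Proof.
apply/funext => z; rewrite iter_adjointE.
by rewrite -[RHS]/(a *: iter n (adjoint T) x z) iter_adjointE.
Qed.

Lemma dual_continuous_Re x : dual V x -> continuous (fun z => Re (x z)).
Proof. by move=> [_ cx] z; apply: continuous_comp; [exact: cx|exact: Re_continuous]. Qed.

Lemma continuous_borel_measurable (f : V -> R) : continuous f ->
  measurable_fun setT (f : borel V -> R).
Proof.
move=> /continuousP cf; apply: (measurability _ (RGenOpens.measurableE R)).
move=> _ [_ [a [b ->] <-]]; rewrite setTI; apply: sub_sigma_algebra.
by apply: cf; exact: interval_open.
Qed.

Lemma dual_measurable_Re x : dual V x ->
  measurable_fun setT (fun z : borel V => Re (x z)).
Proof. by move=> /dual_continuous_Re/continuous_borel_measurable. Qed.

Lemma dual_bounded x : dual V x ->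
  exists2 M : R, 0 <= M & forall z, `|z| <= 1 -> normc (x z) <= M.
Proof.
move=> [lx cx].
pose f := HB.pack_for {linear V -> R[i]^o} x (GRing.isLinear.Build _ _ _ _ _ lx).
have bf : bounded_near f (nbhs (0 : V)).
  by apply: continuous_linear_bounded; exact: cx.
have [M [Mr HM]] := (linear_boundedP f).1 bf.
exists (normc (M + 1)); first exact: normc_ge0.
move=> z z1; rewrite -lecR -!norm_normcE.
apply: le_trans (HM (M + 1) _ z) _; first by rewrite ltrDl.
have r1 : M + 1 \is Num.real by rewrite realD.
apply: le_trans (real_ler_norm _) _; first by rewrite realM// normr_real.
by rewrite normrM normr_id ler_piMr.
Qed.

Lemma dual_norm_ub x z : dual V x -> `|z| <= 1 -> normc (x z) <= dual_norm x.
Proof.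
move=> dx z1; have [M _ xM] := dual_bounded dx.
apply: ub_le_sup; last by exists z.
by exists M => _ [t t1 <-]; exact: xM.
Qed.

End dual_functionals.

(** * Coordinates of sequences *)

(** The control measure adds up its atoms in pairs, at m and at -(m + 1). *)
Lemma esum_int {R : realType} (a : int -> \bar R) : (forall n, 0 <= a n)%E ->
  (\esum_(n in [set: int]) a n = \sum_(m <oo) (a (Posz m) + a (Negz m)))%E.
Proof.
move=> a0; rewrite (esumID [set n : int | 0 <= n]); last by [].
have pos : set_bij [set: nat] ([set: int] `&` [set n : int | 0 <= n]) Posz.
  split=> [//|i j _ _ []//|[m|m] [_ //= _]]; by exists m.
have neg : set_bij [set: nat] ([set: int] `&` ~` [set n : int | 0 <= n]) Negz.
  split=> [//|i j _ _ []//|[m|m] [_ /= m0]]; last by exists m.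
  by exfalso; exact: m0.
rewrite (reindex_esum _ _ _ _ pos) (reindex_esum _ _ _ _ neg).
by rewrite -!nneseries_esumT// nneseriesD.
Qed.

Section lp_space.
Context {R : realType} (p : R) (p1 : 1 <= p).
Local Notation E := (lp p1).
Implicit Types (z : E) (x : E -> R[i]^o).

Let p0 : 0 < p. Proof. exact: lt_le_trans p1. Qed.

Lemma lp_norm_ltP z (e : R) : 0 <= e ->
  (`|z| < e%:C) = (lp_esum p z < (e `^ p)%:E)%E.
Proof.
move=> e0; rewrite lp_normrE ltcR -lte_fin (lp_normE (lp_valP z)).
have := lp_valP z; rewrite lp_predE => zfin.
have S0 := lp_esum_ge0 p z.
have -> : lp_esum p z = (fine (lp_esum p z))%:E by rewrite fineK// ge0_fin_numE.
set S := fine _; have {}S0 : 0 <= S by exact: fine_ge0.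
rewrite poweR_EFin !lte_fin -[X in _ < X](@powRr1 _ e)// -[in LHS](mulfV (lt0r_neq0 p0)) powRrM.
have i0 : 0 < p^-1 by rewrite invr_gt0.
apply/idP/idP => [|h]; last by apply: gt0_ltr_powR; rewrite ?nnegrE ?powR_ge0.
rewrite !ltNge; apply: contra => h.
by apply: ge0_ler_powR; rewrite ?nnegrE ?powR_ge0// ltW.
Qed.

Lemma normc_coord_le z n : normc (z n) <= lp_norm p z.
Proof.
rewrite -lee_fin (lp_normE (lp_valP z)).
have -> : normc (z n) = (normc (z n) `^ p) `^ p^-1.
  by rewrite -powRrM mulfV ?gt_eqF// powRr1// normc_ge0.
rewrite -poweR_EFin; apply: gt0_ler_poweR.
- by rewrite invr_ge0 ltW.
- by rewrite in_itv/= leey lee_fin powR_ge0.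
- by rewrite in_itv/= leey lp_esum_ge0.
apply: esum_ge; exists [set n]; first by split.
by rewrite fsbig_set1.
Qed.

Lemma lp_e_norm_le1 n : `|lp_e p1 n| <= 1.
Proof.
rewrite lp_normrE -[1]/(1%:C) lecR -lee_fin (lp_normE (lp_valP _)) /lp_esum.
rewrite (eq_esum (b := fun m => if m \in [set n] then 1%E else 0%E)) => [|m _].
  by rewrite -(esum_mkcond [set n]) esum_set1// poweR1r.
have -> : (m \in [set n]) = (m == n) by apply/idP/eqP; rewrite inE.
rewrite /=; case: eqP => _; first by rewrite (@normc1 R) powR1.
by rewrite (@normc0 R) powR0 ?gt_eqF.
Qed.

Definition lp_coord (n : int) : E -> R[i]^o := fun z => z n.

Lemma dual_lp_coord n : dual E (lp_coord n).
Proof.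
have lc : linear (lp_coord n) by [].
split=> //.
pose f := HB.pack_for {linear E -> R[i]^o} (lp_coord n)
  (GRing.isLinear.Build _ _ _ _ _ lc).
apply: (@bounded_linear_continuous _ _ _ f).
apply/linear_boundedP; exists 1; split=> // r r1 z.
rewrite -[X in `|X|]/(z n).
apply: le_trans (_ : `|z| <= _); last by rewrite ler_peMl// ltW.
rewrite lp_normrE.

apply: le_trans (_ : (normc (z n))%:C <= _); last by rewrite lecR normc_coord_le.
by case: (z n).
Qed.

End lp_space.

Arguments lp_coord {R p} p1 n.

(** * Trigonometric functions and half-spaces *)

Section trigonometric_functions.
Context {R : realType} (V : normedModType R[i]).
Implicit Types (x y : V -> R[i]^o) (f g : V -> R).

Definition trig_funs : set (V -> R) :=
  [set f | exists x a, dual V x /\ f = fun z => cos (Re (x z) + a)].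

Definition half_spaces : set (set V) :=
  [set A | exists x a, dual V x /\ A = [set z | a < Re (x z)]].

Lemma trig_funs1 : trig_funs (cst 1).
Proof.
exists 0, 0; split; first exact: dual0.
by apply/funext => z /=; rewrite addr0 cos0.
Qed.

Lemma trig_funs_bounded f : trig_funs f -> exists M, forall z, `|f z| <= M.
Proof. by move=> [x [a [_ ->]]]; exists 1 => z; rewrite ler_norml cos_geN1 cos_le1. Qed.

Lemma cosM (a b : R) : cos a * cos b = 1 / 2 * cos (a + b) + 1 / 2 * cos (a - b).
Proof. by rewrite cosD cosB; field. Qed.

Lemma trig_funsM f g : trig_funs f -> trig_funs g ->
  blc trig_funs (fun z => f z * g z).
Proof.
move=> [x [a [dx ->]]] [y [b [dy ->]]].
have Kp : blc trig_funs (fun z => cos (Re ((x + y) z) + (a + b))).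
  by apply: blc_base; exists (x + y), (a + b); split; [exact: dualD|reflexivity].
have Km : blc trig_funs (fun z => cos (Re ((x - y) z) + (a - b))).
  by apply: blc_base; exists (x - y), (a - b); 
  split; [exact: (dualD dx (dualN dy))|reflexivity].
have K1 : blc trig_funs (cst 1) by apply: blc_base; exact: trig_funs1.
have := blc_lin (1 / 2) Kp (blc_lin (1 / 2) Km (blc_lin (-1) K1 K1)).
congr blc; apply/funext => z /=; rewrite cosM.
rewrite -[(x + y) z]/(x z + y z) -[(x - y) z]/(x z - y z) !ReD.
have ReN (t : R[i]) : Re (- t) = - Re t by case: t.
rewrite ReN addrACA (_ : Re (x z) - Re (y z) + (a - b) = Re (x z) + a - (Re (y z) + b)); last by ring.
by ring.
Qed.

Lemma sin_scaled_gt0 (y : R) : \forall n \near \oo, (0 < sin (y / n.+1%:R)) = (0 < y).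
Proof.
near=> n; have n0 : 0 < n.+1%:R :> R by [].
have small : `|y| / n.+1%:R < pi.
  rewrite ltr_pdivrMr// mulrC -ltr_pdivrMr ?pi_gt0//.
  apply: lt_trans (_ : n%:R < _); last by rewrite ltr_nat.
  by near: n; exact: nbhs_infty_gtr.
have [y0|y0|->] := ltgtP y 0; last by rewrite mul0r sin0 ltxx.
- rewrite ltNge; apply/negbTE; rewrite negbK.
  rewrite -[y]opprK mulNr sinN oppr_le0 ltW// sin_gt0_pi//.
  by rewrite divr_gt0 ?oppr_gt0//= -(ltr0_norm y0).
- by rewrite sin_gt0_pi// divr_gt0//= -(gtr0_norm y0).
Unshelve. all: by end_near.
Qed.

(** For n large sin (t / n) has the sign of t, so a half-space is the limit of
    the positivity sets of trigonometric functions. *)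
Lemma blc_half_space A : half_spaces A -> blc trig_funs \1_A.
Proof.
move=> [x [a [dx ->]]].
pose f n z : R := sin ((Re (x z) - a) / n.+1%:R).
have Kf n : blc trig_funs (f n).
  apply: blc_base; exists ((n.+1%:R^-1)%:C *: x), (- a / n.+1%:R - pi / 2).
  split; first exact: dualZ.
  apply/funext => z; rewrite addrA cosBpihalf /f; congr sin.
  rewrite -[(_ *: x) z]/((n.+1%:R^-1)%:C * x z).
  by case: (x z) => u v /=; rewrite mul0r subr0; ring.
apply: (@blc_lim _ _ _ (fun n => \1_[set z | 0 < f n z]) _ 1).
- move=> n; exact: (blc_indic_gt0 trig_funs1 trig_funs_bounded trig_funsM (Kf n)).
- by move=> n z; rewrite indicE; case: (_ \in _); rewrite ?normr1 ?normr0.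
- move=> z; apply: cvg_near_cst.
  have := sin_scaled_gt0 (Re (x z) - a); apply: filterS => n.
  rewrite subr_gt0 => h; rewrite !indicE; congr (_%:R).
  by congr nat_of_bool; apply/idP/idP; rewrite !inE /= /f h.
Qed.

Lemma blc_trig_indic A : <<s half_spaces >> A -> blc trig_funs \1_A.
Proof.
exact: (blc_indic_sigma trig_funs1 trig_funs_bounded trig_funsM blc_half_space).
Qed.

End trigonometric_functions.

Section lp_borel.
Context {R : realType} (p : R) (p1 : 1 <= p).
Local Notation E := (lp p1).
Local Notation E' := (g_sigma_algebraType (@half_spaces R E)).

Let p0 : 0 < p. Proof. exact: lt_le_trans p1. Qed.

Let measurable_Re_dual x : dual E x -> measurable_fun setT (fun z : E' => Re (x z)).
Proof.
move=> dx; apply: (measurability _ (RGenOInfty.measurableE R)).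
move=> _ [_ [a ->] <-]; rewrite setTI; apply: sub_sigma_algebra.
exists x, a; split => //; apply/seteqP.
by split=> z /=; rewrite in_itv/= andbT.
Qed.

(** The p-th power of the norm is a series of functions of coordinates. *)
Lemma measurable_ball_half_spaces (c : E) (e : R) : 0 <= e ->
  <<s @half_spaces R E >> [set z : E | `|c - z| < e%:C].
Proof.
move=> e0; rewrite -[<<s _ >>]/(@measurable _ E').
pose d (n : int) (z : E') : R := normc (c n - (z : E) n) `^ p.
have md n : measurable_fun setT (d n).
  have -> : d n = fun z => ((Re (c n) - Re (lp_coord p1 n z)) ^+ 2 +
      (Im (c n) + Re (('i%C *: lp_coord p1 n) z)) ^+ 2) `^ (p / 2).
    apply/funext => z; rewrite /d -[(_ *: lp_coord _ _) z]/('i%C * (z : E) n) Re_iM.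
    rewrite (_ : lp_coord p1 n z = (z : E) n)//.
    case: (c n) ((z : E) n) => a b [a' b'] /=.
    by rewrite -powR12_sqrt ?addr_ge0 ?sqr_ge0// -powRrM mulrC.
  apply: (measurableT_comp (measurable_powR _)).
  apply: measurable_funD; apply: measurable_funX.
    apply: measurable_funB; first exact: measurable_cst.
    by apply: measurable_Re_dual; exact: dual_lp_coord.
  apply: measurable_funD; first exact: measurable_cst.
  by apply: measurable_Re_dual; apply: dualZ; exact: dual_lp_coord.
have d0 n z : (0 <= (d n z)%:E)%E by rewrite lee_fin powR_ge0.
have mS : measurable_fun setT (fun z : E' => lp_esum p (c - (z : E))).
  have -> : (fun z : E' => lp_esum p (c - (z : E))) =
      fun z => (\sum_(m <oo) ((d (Posz m) z)%:E + (d (Negz m) z)%:E))%E.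
    by apply/funext => z; exact: (esum_int (a := fun n => (d n z)%:E)).
  apply: ge0_emeasurable_sum => [m z _ _|m _]; first by rewrite adde_ge0.
  by apply: emeasurable_funD; apply/measurable_EFinP.
have -> : [set z : E | `|c - z| < e%:C] =
    [set: E'] `&` (fun z : E' => lp_esum p (c - (z : E))) @^-1` [set t | (t < (e `^ p)%:E)%E].
  by rewrite setTI; apply/seteqP; split=> z /=; rewrite lp_norm_ltP.
apply: mS => //.
rewrite (_ : [set t | _] = [set` `]-oo, (e `^ p)%:E[%O]); first exact: emeasurable_itv.
by apply/seteqP; split=> t /=; rewrite in_itv.
Qed.

End lp_borel.

(** * Separability and the Borel sets *)

Section lp_separable.
Context {R : realType} (p : R) (p1 : 1 <= p).
Local Notation E := (lp p1).
Implicit Types z : E.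

Let p0 : 0 < p. Proof. exact: lt_le_trans p1. Qed.

Lemma lp_truncationE z (s : seq int) m : uniq s ->
  (\sum_(n <- s) z n *: lp_e p1 n) m = if m \in s then z m else 0.
Proof.
elim: s => [|a s ih] /=; first by rewrite big_nil.
move=> /andP[as_ us]; rewrite big_cons.
rewrite -[LHS]/(z a * (m == a)%:R + (\sum_(n <- s) z n *: lp_e p1 n) m) ih// in_cons.
have [->|ma] /= := eqVneq m a; first by rewrite (negbTE as_) mulr1 addr0.
by rewrite mulr0 add0r.
Qed.

Lemma lp_truncation_approx z (e : R) : 0 < e ->
  exists s : seq int, `|z - \sum_(n <- s) z n *: lp_e p1 n| < e%:C.
Proof.
move=> e0; pose f n : \bar R := (normc (z n) `^ p)%:E.
have f0 n : (0 <= f n)%E by rewrite lee_fin powR_ge0.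
have zfin : (lp_esum p z < +oo)%E by have := lp_valP z; rewrite lp_predE.
have Sfin : lp_esum p z \is a fin_num by rewrite ge0_fin_numE// lp_esum_ge0.
have ep0 : 0 < e `^ p by exact: powR_gt0.
have [_ [F [finF _] <-] hF] := ub_ereal_sup_adherent ep0 Sfin.
have [s0 Fs] := (finite_seqP F).1 finF; pose s := undup s0.
have sF n : (n \in s) = (n \in F).
  by rewrite mem_undup Fs; apply/idP/idP; rewrite inE.
exists s; rewrite lp_norm_ltP ?ltW//.
set t := \sum_(n <- _) _.
have -> : lp_esum p (z - t) = (\esum_(n in ~` F) f n)%E.
  rewrite esum_mkcond /lp_esum; apply: eq_esum => n _.
  rewrite -[(z - t) n]/(z n - t n) lp_truncationE ?undup_uniq// sF in_setC.
  case: ifPn => _ /=; first by rewrite subrr (@normc0 R) powR0 ?gt_eqF.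
  by rewrite subr0.
have SE : lp_esum p z = (\sum_(n \in F) f n + \esum_(n in ~` F) f n)%E.
  rewrite -[lp_esum p z]/(\esum_(n in [set: int]) f n)%E (esumID F)// !setTI.
  by rewrite esum_fset.
have F0 : (0 <= \esum_(n in ~` F) f n)%E by exact: esum_ge0.
have FS0 : (0 <= \sum_(n \in F) f n)%E by exact: fsume_ge0.
have {}hF : (lp_esum p z - (e `^ p)%:E < \sum_(n \in F) f n)%E := hF.
move: hF; rewrite SE.
move: Sfin; rewrite SE fin_numD => /andP[].
move: (\sum_(n \in F) f n)%E (\esum_(n in ~` F) f n)%E => [a| |] [b| |]// _ _.
by rewrite !lte_fin; lra.
Qed.

Definition rat_comb (s : seq (int * (rat * rat))) : E :=
  \sum_(t <- s) (ratr t.2.1 +i* ratr t.2.2) *: lp_e p1 t.1.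

Lemma complex_rat_approx (c : R[i]) (e : R) : 0 < e ->
  exists q : rat * rat, normc (c - (ratr q.1 +i* ratr q.2)) < e.
Proof.
move=> e0; have e2 : 0 < e / 2 by lra.
have approx (u : R) : exists q : rat, `|u - ratr q| < e / 2.
  have [|q] := @rat_in_itvoo R (u - e / 2) (u + e / 2); first by lra.
  by rewrite in_itv/= => /andP[? ?]; exists q; rewrite ltr_norml; lra.
have [q1 h1] := approx (Re c); have [q2 h2] := approx (Im c).
exists (q1, q2); apply: le_lt_trans (normc_le_ReIm _) _.
by case: c h1 h2 => a b /= h1 h2; lra.
Qed.

Lemma rat_comb_dense z (e : R) : 0 < e -> exists s, `|z - rat_comb s| < e%:C.
Proof.
move=> e0; have e2 : 0 < e / 2 by lra.
have [s zs] := lp_truncation_approx z e2.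
suff [t st] : exists t, `|\sum_(n <- s) z n *: lp_e p1 n - rat_comb t| < (e / 2)%:C.
  exists t; rewrite -(subrK (\sum_(n <- s) z n *: lp_e p1 n) z) -addrA.
  apply: le_lt_trans (ler_normD _ _) _.
  by rewrite (splitr e) rmorphD ltrD.
elim: s {zs} (e / 2) e2 => [|n s ih] d d0.
  by exists [::]; rewrite /rat_comb !big_nil subrr normr0 ltcR.
have d2 : 0 < d / 2 by lra.
have [t st] := ih _ d2; have [q zq] := complex_rat_approx (z n) d2.
exists ((n, q) :: t); rewrite /rat_comb !big_cons opprD addrACA -scalerBl.
apply: le_lt_trans (ler_normD _ _) _; rewrite [X in _ < X%:C]splitr rmorphD ltr_leD//.
  rewrite normrZ; apply: le_lt_trans (_ : (normc (z n - (ratr q.1 +i* ratr q.2)))%:C < _).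
    by rewrite -norm_normcE; apply: ler_piMr => //; exact: lp_e_norm_le1.
  by rewrite ltcR.
exact: ltW.
Qed.

Lemma open_half_spaces (U : set E) : open U -> <<s @half_spaces R E >> U.
Proof.
move=> oU.
(* the countably many balls with centres in the dense set and radii 1/(k+1) *)
pose B (s : seq (int * (rat * rat))) (k : nat) : set E :=
  [set z | `|rat_comb s - z| < (k.+1%:R^-1)%:C].
pose C : countType := (seq (int * (rat * rat)) * nat)%type.
pose F (i : nat) : set E := if @unpickle C i is Some (s, k)
  then if `[< B s k `<=` U >] then B s k else set0 else set0.
have -> : U = \bigcup_i F i.
  apply/seteqP; split=> [z Uz|z [i _]]; last first.
    by rewrite /F; case: (@unpickle C i) => [[s k]|//]; case: ifPn => // /asboolP BU /BU.
  have [e e0 eU] : exists2 e : R, 0 < e & forall y : E, `|z - y| < e%:C -> U y.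
    have /nbhs_normP[e /= e0 eU] : nbhs z U by exact: open_nbhs_nbhs.
    have er : e \is Num.real by rewrite realE ltW.
    have eE : e = (Re e)%:C by case: e {e0 eU} er => a b; rewrite complex_real => /eqP /= ->.
    by exists (Re e); [rewrite -ltcR -eE|rewrite -eE => y; exact: eU].
  have [k ke] : exists k : nat, k.+1%:R^-1 < e / 2.
    have [k _ hk] : \forall k \near \oo, (k.+1%:R^-1 : R) < e / 2.
      by near=> k; near: k; apply: near_infty_natSinv_lt (PosNum (_ : 0 < e / 2)); lra.
    by exists k; exact: (hk k (leqnn k)).
  have [s zs] := @rat_comb_dense z k.+1%:R^-1 ltac:(by rewrite invr_gt0).
  exists (@pickle C (s, k)) => //; rewrite /F pickleK ifT; first by rewrite /B /= distrC.
  apply/asboolP => y; rewrite /B /= => sy; apply: eU.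
  rewrite -(subrK (rat_comb s) z) -addrA; apply: le_lt_trans (ler_normD _ _) _.
  apply: lt_trans (ltrD zs sy) _.
  by rewrite -rmorphD ltcR [ltRHS]splitr ltrD.
rewrite -[<<s _ >>]/(@measurable _ (g_sigma_algebraType (@half_spaces R E))).
apply: bigcupT_measurable => i; rewrite /F; case: (@unpickle C i) => [[s k]|]; last exact: measurable0.
case: ifP => _; last exact: measurable0.
exact: measurable_ball_half_spaces.
Unshelve. all: by end_near.
Qed.

(** Separability makes the open sets countable unions of balls, and balls are
    defined by countably many coordinates. *)
Lemma borel_half_spaces (A : set (borel E)) : measurable A -> <<s @half_spaces R E >> A.
Proof.
apply: smallest_sub; first exact: smallest_sigma_algebra.
by move=> U; exact: open_half_spaces.
Qed.

End lp_separable.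

(** * Invariance and decorrelation under bounded limits *)

Section interchange.
Context {R : realType}.

(** Two limits are exchanged: c k approximates c' uniformly in the index n of
    the limit, here the number of iterations. *)
Lemma cvg_uniform_approx (c : nat -> nat -> R) (L delta c' : nat -> R) (l : R) :
  (forall k, c k n @[n --> \oo] --> L k) ->
  (forall k n, `|c' n - c k n| <= delta k) -> (forall k, `|l - L k| <= delta k) ->
  delta k @[k --> \oo] --> 0 -> c' n @[n --> \oo] --> l.
Proof.
move=> cL cc' lL d0; apply/cvgrPdist_lt => e e0.
have e3 : 0 < e / 3 by lra.
have [k _ hk] := cvgr0_norm_lt _ d0 _ e3.
have {hk} dk : delta k < e / 3 by apply: le_lt_trans (ler_norm _) (hk k (leqnn k)).
have /cvgrPdist_lt/(_ _ e3) := cL k; apply: filterS => n hn.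
rewrite (_ : l - c' n = (l - L k) + (L k - c k n) - (c' n - c k n)); last by ring.
have := ler_normB ((l - L k) + (L k - c k n)) (c' n - c k n).
have := ler_normD (l - L k) (L k - c k n).
by have := cc' k n; have := lL k; lra.
Qed.

End interchange.

Section bounded_integrals.
Context {d : measure_display} {X : measurableType d} {R : realType}.
Context (mu : probability X R).
Implicit Types f g : X -> R.

Lemma bounded_integrable f (M : R) : measurable_fun setT f ->
  (forall x, `|f x| <= M) -> mu.-integrable setT (EFin \o f).
Proof.
move=> mf fM; apply: measurable_bounded_integrable => //.
  exact: le_lt_trans (probability_le1 mu measurableT) (ltry 1).
exists M; split; first exact: num_real.
by move=> y My x _; apply: le_trans (fM x) (ltW My).
Qed.

Lemma Rintegral_norm_cvg0 (u : nat -> X -> R) f (M : R) :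
  (forall n, measurable_fun setT (u n)) -> (forall n x, `|u n x| <= M) ->
  (forall x, u n x @[n --> \oo] --> f x) ->
  (\int[mu]_x `|f x - u n x|) @[n --> \oo] --> (0 : R).
Proof.
move=> mu_ uM uf.
have mf : measurable_fun setT f by apply: (measurable_fun_cvg mu_) => x _; exact: uf.
have intM : mu.-integrable setT (EFin \o (cst M : X -> R)).
  by apply: (bounded_integrable (M := `|M|)) => //; exact: measurable_cst.
have [| | | | |_ + _] := @dominated_convergence _ X R mu setT measurableT
  (fun n => EFin \o u n) (EFin \o f) (EFin \o cst M).
- by move=> n; exact/measurable_EFinP.
- exact/measurable_EFinP.
- by apply: aeW => x _; apply: cvg_EFin; [near=> n|exact: uf].
- exact: intM.
- by apply: aeW => x n _; rewrite lee_fin.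
move=> /fine_cvg; apply: cvg_trans; apply: near_eq_cvg; near=> n.
rewrite /= /Rintegral; congr fine; apply: eq_integral => x _ /=.
by rewrite distrC.
Unshelve. all: by end_near.
Qed.

Lemma norm_RintegralB_le f g (M N : R) : measurable_fun setT f -> measurable_fun setT g ->
  (forall x, `|f x| <= M) -> (forall x, `|g x| <= N) ->
  `|\int[mu]_x f x - \int[mu]_x g x| <= \int[mu]_x `|f x - g x|.
Proof.
move=> mf mg fM gN.
have fi := bounded_integrable mf fM; have gi := bounded_integrable mg gN.
rewrite -RintegralB//; apply: le_normr_Rintegral => //.
apply: (bounded_integrable (M := M + N)); first exact: measurable_funB.
by move=> x; apply: le_trans (ler_normB _ _) _; rewrite lerD.
Qed.

Lemma cvg_Rintegral (u : nat -> X -> R) f (M N : R) :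
  (forall n, measurable_fun setT (u n)) -> (forall n x, `|u n x| <= M) ->
  measurable_fun setT f -> (forall x, `|f x| <= N) ->
  (forall x, u n x @[n --> \oo] --> f x) ->
  (\int[mu]_x u n x) @[n --> \oo] --> \int[mu]_x f x.
Proof.
move=> mu_ uM mf fN uf; apply/cvgrPdist_lt => e e0.
have := cvgr0_norm_lt _ (Rintegral_norm_cvg0 mu_ uM uf) _ e0.
move=> /(_ eventually_filter); apply: filterS => n; apply: le_lt_trans.
by apply: le_trans (ler_norm _); exact: norm_RintegralB_le.
Qed.

Lemma Rintegral_lin (a : R) f g (M N : R) : measurable_fun setT f -> measurable_fun setT g ->
  (forall x, `|f x| <= M) -> (forall x, `|g x| <= N) ->
  \int[mu]_x (a * f x + g x) = a * \int[mu]_x f x + \int[mu]_x g x.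
Proof.
move=> mf mg fM gN.
have fi := bounded_integrable mf fM; have gi := bounded_integrable mg gN.
rewrite RintegralD// ?RintegralZl//.
by have := integrableZl measurableT a fi; apply: eq_integrable.
Qed.

Lemma Rintegral_preserving (S : X -> X) (h : X -> R) : measurable_fun setT S ->
  (forall A, measurable A -> mu (S @^-1` A) = mu A) ->
  measurable_fun setT h -> (forall x, 0 <= h x) ->
  \int[mu]_x h (S x) = \int[mu]_x h x.
Proof.
move=> mS muS mh h0; rewrite /Rintegral; congr fine.
have mEh : measurable_fun setT (EFin \o h) by exact/measurable_EFinP.
have := @ge0_integral_pushforward _ _ _ _ _ _ mS mu setT _ measurableT mEh.
rewrite preimage_setT => <- //; last by move=> x _; rewrite lee_fin.
apply: eq_measure_integral => A mA _; exact: muS.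
Qed.

Variable K : set (X -> R).
Hypothesis Kmeas : forall f, K f -> measurable_fun setT f.
Hypothesis Kbnd : forall f, K f -> exists M, forall x, `|f x| <= M.

Lemma blc_measurable f : blc K f -> measurable_fun setT f.
Proof.
elim=> {f} [f /Kmeas//|a f g _ mf _ mg|u f M _ mu_ _ uf].
  by apply: measurable_funD => //; apply: measurable_funM => //; exact: measurable_cst.
by apply: (measurable_fun_cvg mu_) => x _; exact: uf.
Qed.

Lemma blc_preserving (S : X -> X) : measurable_fun setT S ->
  (forall f, K f -> \int[mu]_x f (S x) = \int[mu]_x f x) ->
  forall f, blc K f -> \int[mu]_x f (S x) = \int[mu]_x f x.
Proof.
move=> mS KS f Kf; elim: Kf => {f} [f /KS//|a f g Kf ihf Kg ihg|u f M Ku ih uM uf].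
  have [Mf fM] := blc_bounded Kbnd Kf; have [Mg gM] := blc_bounded Kbnd Kg.
  have mf := blc_measurable Kf; have mg := blc_measurable Kg.
  rewrite (Rintegral_lin a mf mg fM gM) -ihf -ihg.
  exact: (Rintegral_lin a (measurableT_comp mf mS) (measurableT_comp mg mS)
    (fun x => fM (S x)) (fun x => gM (S x))).
have mu_ n := blc_measurable (Ku n).
have [N fN] := blc_bounded Kbnd (blc_lim Ku uM uf).
have mf := blc_measurable (blc_lim Ku uM uf).
have lim1 := cvg_Rintegral mu_ uM mf fN uf.
have lim2 := cvg_Rintegral (fun n => measurableT_comp (mu_ n) mS)
  (fun n x => uM n (S x)) (measurableT_comp mf mS) (fun x => fN (S x)) (fun x => uf (S x)).
apply: (cvg_unique (@Rhausdorff R) lim2).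
suff -> : (fun n => \int[mu]_x (u n \o S) x) = (fun n => \int[mu]_x u n x) by [].
by apply/funext => n; exact: ih.
Qed.

Section mixing.
Variable S : nat -> X -> X.
Hypothesis mS : forall n, measurable_fun setT (S n).
Hypothesis muS : forall n A, measurable A -> mu (S n @^-1` A) = mu A.

Definition decorrelates f g :=
  (\int[mu]_x (f x * g (S n x))) @[n --> \oo] --> (\int[mu]_x f x) * (\int[mu]_x g x).

Lemma decorrelates_lim_l (u : nat -> X -> R) f g (M : R) :
  (forall n, blc K (u n)) -> (forall n x, `|u n x| <= M) ->
  (forall x, u n x @[n --> \oo] --> f x) -> blc K g ->
  (forall n, decorrelates (u n) g) -> decorrelates f g.
Proof.
move=> Ku uM uf Kg ug.
have mu_ n := blc_measurable (Ku n); have mg := blc_measurable Kg.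
have mf := blc_measurable (blc_lim Ku uM uf).
have [N fN] := blc_bounded Kbnd (blc_lim Ku uM uf).
have [G gG] := blc_bounded Kbnd Kg.
have G0 : 0 <= G by apply: le_trans (gG point).
pose I k : R := \int[mu]_x `|f x - u k x|.
have mfu k : measurable_fun setT (fun x => `|f x - u k x|).
  by apply: measurableT_comp => //; exact: measurable_funB.
have fuM k x : `|f x - u k x| <= N + M.
  by apply: le_trans (ler_normB _ _) _; rewrite lerD.
have intfu k : mu.-integrable setT (EFin \o (fun x => `|f x - u k x|)).
  by apply: (bounded_integrable (M := N + M)) => // x; rewrite normr_id.
apply: (cvg_uniform_approx (L := fun k => (\int[mu]_x u k x) * (\int[mu]_x g x))
  (delta := fun k => G * I k) ug).
- move=> k n; have mgS := measurableT_comp mg (mS n).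
  apply: le_trans (norm_RintegralB_le (M := N * G) (N := M * G) _ _ _ _) _.
  + exact: measurable_funM.
  + exact: measurable_funM.
  + by move=> x; rewrite normrM ler_pM.
  + by move=> x; rewrite normrM ler_pM.
  rewrite -RintegralZl//; apply: le_Rintegral => //.
  + apply: (bounded_integrable (M := (N + M) * G)).
      by apply: measurableT_comp => //; apply: measurable_funB; exact: measurable_funM.
    by move=> x; rewrite normr_id -mulrBl normrM ler_pM.
  + by have := integrableZl measurableT G (intfu k); apply: eq_integrable.
  + by move=> x _; rewrite -mulrBl normrM mulrC ler_wpM2r.
- move=> k; rewrite -mulrBl normrM mulrC ler_pM//.
    have gi := bounded_integrable mg gG.
    apply: le_trans (le_normr_Rintegral measurableT gi) _.
    apply: le_trans (_ : \int[mu]_x (cst G x) <= _).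
      apply: le_Rintegral => //.
      + by apply: (bounded_integrable (M := G)); [exact: measurableT_comp|move=> x; rewrite normr_id].
      + by apply: (bounded_integrable (M := G)) => // x; rewrite /= ger0_norm.
    by rewrite Rintegral_cst//= probability_setT/= mulr1.
  exact: norm_RintegralB_le.
- rewrite -[X in _ --> X](mulr0 G); apply: cvgMr.
  exact: Rintegral_norm_cvg0.
Qed.

(** The maps preserve mu, so that the integral of |g - u k| composed with any
    S n is that of |g - u k|: the approximation is uniform in n. *)
Lemma decorrelates_lim_r (u : nat -> X -> R) f g (M : R) :
  (forall n, blc K (u n)) -> (forall n x, `|u n x| <= M) ->
  (forall x, u n x @[n --> \oo] --> g x) -> blc K f ->
  (forall n, decorrelates f (u n)) -> decorrelates f g.
Proof.
move=> Ku uM ug Kf fu.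
have mu_ n := blc_measurable (Ku n); have mf := blc_measurable Kf.
have mg := blc_measurable (blc_lim Ku uM ug).
have [N gN] := blc_bounded Kbnd (blc_lim Ku uM ug).
have [F fF] := blc_bounded Kbnd Kf.
have F0 : 0 <= F by apply: le_trans (fF point).
pose I k : R := \int[mu]_x `|g x - u k x|.
have mgu k : measurable_fun setT (fun x => `|g x - u k x|).
  by apply: measurableT_comp => //; exact: measurable_funB.
have guM k x : `|g x - u k x| <= N + M.
  by apply: le_trans (ler_normB _ _) _; rewrite lerD.
have intguS k n : mu.-integrable setT (EFin \o (fun x => `|g (S n x) - u k (S n x)|)).
  apply: (bounded_integrable (M := N + M)) => [|x]; last by rewrite normr_id.
  exact: (measurableT_comp (mgu k) (mS n)).
have IS k n : I k = \int[mu]_x `|g (S n x) - u k (S n x)|.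
  by rewrite (Rintegral_preserving (mS n) (muS n) (mgu k)).
apply: (cvg_uniform_approx (L := fun k => (\int[mu]_x f x) * (\int[mu]_x u k x))
  (delta := fun k => F * I k) fu).
- move=> k n; have mgS := measurableT_comp mg (mS n).
  have muS_ := measurableT_comp (mu_ k) (mS n).
  apply: le_trans (norm_RintegralB_le (M := F * N) (N := F * M) _ _ _ _) _.
  + exact: measurable_funM.
  + exact: measurable_funM.
  + by move=> x; rewrite normrM ler_pM.
  + by move=> x; rewrite normrM ler_pM.
  rewrite (IS k n) -RintegralZl//; apply: le_Rintegral => //.
  + apply: (bounded_integrable (M := F * (N + M))).
      by apply: measurableT_comp => //; apply: measurable_funB; exact: measurable_funM.
    by move=> x; rewrite normr_id -mulrBr normrM ler_pM.
  + by have := integrableZl measurableT F (intguS k n); apply: eq_integrable.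
  + by move=> x _; rewrite -mulrBr normrM ler_wpM2r.
- move=> k; rewrite -mulrBr normrM ler_pM//.
    have fi := bounded_integrable mf fF.
    apply: le_trans (le_normr_Rintegral measurableT fi) _.
    apply: le_trans (_ : \int[mu]_x (cst F x) <= _).
      apply: le_Rintegral => //.
      + by apply: (bounded_integrable (M := F)); [exact: measurableT_comp|move=> x; rewrite normr_id].
      + by apply: (bounded_integrable (M := F)) => // x; rewrite /= ger0_norm.
    by rewrite Rintegral_cst//= probability_setT/= mulr1.
  exact: norm_RintegralB_le.
- rewrite -[X in _ --> X](mulr0 F); apply: cvgMr.
  exact: Rintegral_norm_cvg0.
Qed.

Lemma decorrelates_lin_l (a : R) f1 f2 g : blc K f1 -> blc K f2 -> blc K g ->
  decorrelates f1 g -> decorrelates f2 g ->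
  decorrelates (fun x => a * f1 x + f2 x) g.
Proof.
move=> K1 K2 Kg h1 h2; rewrite /decorrelates.
have [M1 b1] := blc_bounded Kbnd K1; have [M2 b2] := blc_bounded Kbnd K2.
have [G bg] := blc_bounded Kbnd Kg.
have m1 := blc_measurable K1; have m2 := blc_measurable K2; have mg := blc_measurable Kg.
rewrite (Rintegral_lin a m1 m2 b1 b2) mulrDl -mulrA.
have -> : (fun n => \int[mu]_x ((a * f1 x + f2 x) * g (S n x))) =
    fun n => a * \int[mu]_x (f1 x * g (S n x)) + \int[mu]_x (f2 x * g (S n x)).
  apply/funext => n; have mgS := measurableT_comp mg (mS n).
  rewrite -(@Rintegral_lin a _ _ (M1 * G) (M2 * G)); last 4 first.
  - exact: measurable_funM.
  - exact: measurable_funM.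
  - by move=> x; rewrite normrM ler_pM.
  - by move=> x; rewrite normrM ler_pM.
  by apply: eq_Rintegral => x _; ring.
by apply: cvgD => //; apply: cvgMr.
Qed.

Lemma decorrelates_lin_r (a : R) f g1 g2 : blc K f -> blc K g1 -> blc K g2 ->
  decorrelates f g1 -> decorrelates f g2 ->
  decorrelates f (fun x => a * g1 x + g2 x).
Proof.
move=> Kf K1 K2 h1 h2; rewrite /decorrelates.
have [M1 b1] := blc_bounded Kbnd K1; have [M2 b2] := blc_bounded Kbnd K2.
have [F bf] := blc_bounded Kbnd Kf.
have m1 := blc_measurable K1; have m2 := blc_measurable K2; have mf := blc_measurable Kf.
rewrite (Rintegral_lin a m1 m2 b1 b2) mulrDr mulrCA.
have -> : (fun n => \int[mu]_x (f x * (a * g1 (S n x) + g2 (S n x)))) =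
    fun n => a * \int[mu]_x (f x * g1 (S n x)) + \int[mu]_x (f x * g2 (S n x)).
  apply/funext => n; have m1S := measurableT_comp m1 (mS n).
  have m2S := measurableT_comp m2 (mS n).
  rewrite -(@Rintegral_lin a _ _ (F * M1) (F * M2)); last 4 first.
  - exact: measurable_funM.
  - exact: measurable_funM.
  - by move=> x; rewrite normrM ler_pM.
  - by move=> x; rewrite normrM ler_pM.
  by apply: eq_Rintegral => x _; ring.
by apply: cvgD => //; apply: cvgMr.
Qed.

(** The left argument is extended first, against a fixed element of K, then the
    right one against an arbitrary element of the closure. *)
Lemma blc_decorrelates : (forall f g, K f -> K g -> decorrelates f g) ->
  forall f g, blc K f -> blc K g -> decorrelates f g.
Proof.
move=> KK f g Kf Kg.
have base h : K h -> decorrelates f h.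
  move=> Kh; have Kh' := blc_base Kh.
  elim: Kf => {f} [f Kf|a f1 f2 K1 ih1 K2 ih2|u f M Ku ih uM uf].
  - exact: KK.
  - exact: decorrelates_lin_l.
  - exact: decorrelates_lim_l Ku uM uf Kh' ih.
elim: Kg => {g} [g /base//|a g1 g2 K1 ih1 K2 ih2|u g M Ku ih uM ug].
  exact: decorrelates_lin_r.
exact: decorrelates_lim_r Ku uM ug Kf ih.
Qed.

End mixing.
End bounded_integrals.

(** * Integrals against the control measure *)

Lemma dual_scale {R : realType} (V : normedModType R[i]) (x : V -> R[i]^o) (a : R[i]) z :
  dual V x -> x (a *: z) = a * x z.
Proof.
move=> [lx _]; have x0 : x 0 = 0.
  by have := lx (-1) 0 0; rewrite !scaleN1r addr0 oppr0 addNr.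
by have := lx a z 0; rewrite x0 !addr0.
Qed.

Lemma measurable_dual_powR {R : realType} (V : normedModType R[i])
    (beta : R) (x : V -> R[i]^o) : dual V x ->
  measurable_fun setT (fun z : borel V => `|Re (x z)| `^ beta).
Proof.
move=> dx; apply: (measurableT_comp (measurable_powR _)).
by apply: measurableT_comp => //; exact: dual_measurable_Re.
Qed.

Section stable_integrals.
Context {R : realType} (p : R) (p1 : 1 <= p) (alpha : R) (k : int -> R).
Local Notation E := (lp p1).
Local Notation xi := (control_measure p1 alpha k).
Local Notation e_ := (lp_e p1).
Hypotheses (alpha0 : 0 < alpha) (alpha2 : alpha < 2).
Hypothesis k0 : forall n, 0 <= k n.
Hypothesis klalpha : in_lalpha alpha k.

Lemma integral_control_measure (f : E -> R) : measurable_fun setT (f : borel E -> R) ->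
  (forall z, 0 <= f z) ->
  (\int[xi]_z (f z)%:E = (2^-1)%:E *
    \esum_(n in [set: int]) (k n `^ alpha * (f (e_ n) + f ('i%C *: e_ n)))%:E)%E.
Proof.
move=> mf f0; rewrite /control_measure.
have mEf : measurable_fun setT (fun z : borel E => (f z)%:E) by exact/measurable_EFinP.
have Ef0 (z : borel E) : [set: borel E] z -> (0 <= (f z)%:E)%E by rewrite lee_fin.
rewrite ge0_integral_mscale// ge0_integral_measure_series//; congr (_ * _)%E.
rewrite esum_int; last by move=> n; rewrite lee_fin mulr_ge0 ?powR_ge0 ?addr_ge0.
have atomE n : (\int[atoms p1 alpha k n]_z (f z)%:E =
    (k n `^ alpha * (f (e_ n) + f ('i%C *: e_ n)))%:E)%E.
  rewrite /atoms ge0_integral_mscale// ge0_integral_measure_add//.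
  by rewrite !integral_dirac// !diracT !mul1e.
by apply: eq_eseriesr => m _; rewrite ge0_integral_measure_add// !atomE.
Qed.

Lemma integral_control_measure_Re (beta : R) x y : dual E x -> dual E y ->
  (\int[xi]_z (`|Re (x z)| `^ beta * `|Re (y z)| `^ beta)%:E = (2^-1)%:E *
    \esum_(n in [set: int]) (k n `^ alpha *
      (`|Re (x (e_ n))| `^ beta * `|Re (y (e_ n))| `^ beta
       + `|Im (x (e_ n))| `^ beta * `|Im (y (e_ n))| `^ beta))%:E)%E.
Proof.
move=> dx dy.
rewrite integral_control_measure; last 2 first.
- exact: (measurable_funM (measurable_dual_powR _ dx) (measurable_dual_powR _ dy)).
- by move=> z; rewrite mulr_ge0 ?powR_ge0.
congr (_ * _)%E; apply: eq_esum => n _.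
by rewrite !dual_scale// !Re_iM !normrN.
Qed.

Lemma stable_integralE x : dual E x ->
  (\int[xi]_z (`|Re (x z)| `^ alpha)%:E = (2^-1)%:E *
    \esum_(n in [set: int]) (k n `^ alpha *
      (`|Re (x (e_ n))| `^ alpha + `|Im (x (e_ n))| `^ alpha))%:E)%E.
Proof.
move=> dx; have half (r : R) : `|r| `^ alpha = `|r| `^ (alpha / 2) * `|r| `^ (alpha / 2).
  have [->|r0] := eqVneq r 0; first by rewrite normr0 !powR0 ?mul0r// gt_eqF// divr_gt0.
  by rewrite -powRD -?splitr// normr_eq0 r0 implybT.
under eq_integral do rewrite half.
by rewrite integral_control_measure_Re//; congr (_ * _)%E; apply: eq_esum => n _; rewrite -!half.
Qed.

Lemma normc_dual_e_le x n : dual E x -> normc (x (e_ n)) <= dual_norm x.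
Proof. by move=> dx; apply: dual_norm_ub => //; exact: lp_e_norm_le1. Qed.

Lemma dual_norm_ge0 x : dual E x -> 0 <= dual_norm x.
Proof. by move=> /(normc_dual_e_le 0); apply: le_trans; exact: normc_ge0. Qed.

Lemma esum_k_lty : (\esum_(n in [set: int]) (k n `^ alpha)%:E < +oo)%E.
Proof.
have := klalpha; rewrite /in_lalpha /summable; under eq_esum do rewrite ger0_norm//.
by under eq_esum do rewrite abse_EFin ger0_norm ?powR_ge0//.
Qed.

Lemma stable_integrable x : dual E x ->
  xi.-integrable setT (EFin \o (fun z : borel E => `|Re (x z)| `^ alpha)).
Proof.
move=> dx; apply/integrableP; split.
  by apply/measurable_EFinP; exact: measurable_dual_powR.
under eq_integral do rewrite /= ger0_norm ?powR_ge0//.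
rewrite stable_integralE// lte_mul_pinfty// ?lee_fin ?invr_ge0//.
apply: (@le_lt_trans _ _ ((2 * dual_norm x `^ alpha)%:E *
    \esum_(n in [set: int]) (k n `^ alpha)%:E)%E); last first.
  by rewrite lte_mul_pinfty ?esum_k_lty// lee_fin mulr_ge0 ?powR_ge0.
apply: le_trans (esumZl_le _ _ _); last 2 first.
- by rewrite mulr_ge0 ?powR_ge0.
- by move=> n; rewrite lee_fin powR_ge0.
apply: le_esum => n _; rewrite -EFinM lee_fin mulrC; apply: ler_wpM2r; first exact: powR_ge0.
have hx := normc_dual_e_le n dx; have N0 := dual_norm_ge0 dx.
have pw (u : R) : `|u| <= normc (x (e_ n)) -> `|u| `^ alpha <= dual_norm x `^ alpha.
  by move=> hu; apply: ge0_ler_powR; rewrite ?nnegrE ?(ltW alpha0)// (le_trans hu).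
have := pw _ (norm_Re_le (x (e_ n))); have := pw _ (norm_Im_le (x (e_ n))); lra.
Qed.

Local Notation psi := (stable_exponent alpha xi).

(** The additivity defect of the power alpha is at most a product of powers
    alpha/2, so that two functionals interact only through the atoms on which
    both are nonzero. *)
Lemma stable_exponent_defect x y : dual E x -> dual E y ->
  ((`|psi (x + y) - psi x - psi y|)%:E <= 4%:E *
    \esum_(n in [set: int]) (k n `^ alpha *
      (normc (x (e_ n)) `^ (alpha / 2) * normc (y (e_ n)) `^ (alpha / 2)))%:E)%E.
Proof.
move=> dx dy; have dxy := dualD dx dy.
have [ix iy ixy] := And3 (stable_integrable dx) (stable_integrable dy) (stable_integrable dxy).
pose D (z : borel E) : R := `|Re ((x + y) z)| `^ alpha - `|Re (x z)| `^ alpha - `|Re (y z)| `^ alpha.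
have ixyx := integrableB measurableT ixy ix.
have iD : xi.-integrable setT (EFin \o D) by exact: (integrableB measurableT ixyx iy).
have -> : psi (x + y) - psi x - psi y = - \int[xi]_z D z.
  have -> : \int[xi]_z D z = (\int[xi]_z (`|Re ((x + y) z)| `^ alpha - `|Re (x z)| `^ alpha))
      - \int[xi]_z (`|Re (y z)| `^ alpha) by exact: (RintegralB measurableT ixyx iy).
  have -> : \int[xi]_z (`|Re ((x + y) z)| `^ alpha - `|Re (x z)| `^ alpha) =
      - psi (x + y) + psi x by rewrite !opprK; exact: (RintegralB measurableT ixy ix).
  have -> : \int[xi]_z (`|Re (y z)| `^ alpha) = - psi y by rewrite opprK.
  by move: (psi _) (psi x) (psi y) => a b c; ring.
rewrite normrN EFin_normr_Rintegral//.
apply: le_trans (le_abse_integral _ _ _) _ => //; first by case/integrableP: iD.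
have a20 : 0 <= alpha / 2 by rewrite divr_ge0 ?(ltW alpha0).
pose h (z : borel E) : R := `|Re (x z)| `^ (alpha / 2) * `|Re (y z)| `^ (alpha / 2).
have mh : measurable_fun setT h.
  exact: (measurable_funM (measurable_dual_powR _ dx) (measurable_dual_powR _ dy)).
have h0 z : 0 <= h z by rewrite mulr_ge0 ?powR_ge0.
apply: (@le_trans _ _ (\int[xi]_z (4%:E * (h z)%:E))%E).
  apply: ge0_le_integral => //.
  - by apply: measurableT_comp => //; case/integrableP: iD.
  - by apply: emeasurable_funM; [exact: measurable_cst|apply/measurable_EFinP].
  move=> z _; rewrite -EFinM lee_fin /D.
  rewrite (_ : Re ((x + y) z) = Re (x z) + Re (y z)); last exact: ReD.
  by apply: norm_powR_defect => //; exact: ltW.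
have mEh : measurable_fun setT (EFin \o h) by exact/measurable_EFinP.
rewrite ge0_integralZl//; last by move=> z _; rewrite lee_fin.
apply: lee_wpmul2l; first by rewrite lee_fin.
rewrite (integral_control_measure_Re (alpha / 2) dx dy).
set b := alpha / 2 in a20 *.
apply: (@le_trans _ _ ((2^-1)%:E * \esum_(n in [set: int]) (2%:E * (k n `^ alpha *
      (normc (x (e_ n)) `^ b * normc (y (e_ n)) `^ b))%:E))%E).
  apply: lee_wpmul2l; first by rewrite lee_fin invr_ge0.
  apply: le_esum => n _; rewrite -EFinM lee_fin mulrCA.
  apply: ler_wpM2l; first exact: powR_ge0.
  have pw (u v : R) : `|u| <= v -> `|u| `^ b <= v `^ b.
    by move=> uv; apply: ge0_ler_powR; rewrite ?nnegrE// (le_trans _ uv).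
  rewrite mulr_natl mulr2n; apply: lerD; apply: ler_pM; rewrite ?powR_ge0//; apply: pw.
  - exact: norm_Re_le.
  - exact: norm_Re_le.
  - exact: norm_Im_le.
  - exact: norm_Im_le.
apply: le_trans (lee_wpmul2l _ (esumZl_le _ _ _)) _ => //.
  by move=> n; rewrite lee_fin !mulr_ge0 ?powR_ge0.
by rewrite muleA -EFinM mulVf// mul1e.
Qed.

End stable_integrals.

(** * The exponent along the weighted shift *)

Lemma kseqS {R : realType} (k0 : R) (w : int -> R) (n : int) :
  (forall m, 0 < w m) -> kseq k0 w (n + 1) = w (n + 1) * kseq k0 w n.
Proof.
move=> w_gt0; case: n => [m|m].
  have -> : (Posz m + 1 = m.+1%:Z)%R by lia.
  by rewrite /= big_nat_recr//= mulrA mulrC.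
have -> : (Negz m + 1 = - m%:Z)%R by lia.
have -> : kseq k0 w (Negz m) =
    (k0 * \prod_(0 <= j < m) (w (- j%:Z))^-1) * (w (- m%:Z))^-1.
  by rewrite /= big_nat_recr//= mulrA.
rewrite mulrCA mulfV ?gt_eqF// mulr1.
case: m => [|m]; first by rewrite oppr0 /= big_geq// big_geq.
by rewrite (_ : - m.+1%:Z = Negz m).
Qed.

Lemma kseq_gt0 {R : realType} (k0 : R) (w : int -> R) (n : int) :
  0 < k0 -> (forall m, 0 < w m) -> 0 < kseq k0 w n.
Proof.
move=> k0_gt0 w_gt0.
by case: n => m /=; rewrite mulr_gt0// prodr_gt0// => i _; rewrite ?invr_gt0.
Qed.

Lemma le_shift_of_absz (q r m : int) : 0 <= q -> 0 <= r ->
  (`|q| + `|r|)%N%:Z <= m -> r <= m + 1.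
Proof. lia. Qed.

Lemma le_oppr_of_absz (q r m : int) : 0 <= q -> 0 <= r ->
  m <= - (`|q| + `|r|)%N%:Z -> m <= - q.
Proof. lia. Qed.

Lemma stable_exponentN {R : realType} (V : normedModType R[i]) (alpha : R)
    (xi : {measure set (borel V) -> \bar R}) (x : V -> R[i]^o) :
  stable_exponent alpha xi (- x) = stable_exponent alpha xi x.
Proof.
rewrite /stable_exponent; congr (- _); apply: eq_Rintegral => z _.
rewrite -[(- x) z]/(- (x z)); congr (_ `^ _).
by case: (x z) => a b /=; rewrite normrN.
Qed.

Section weighted_shift_exponent.
Context {R : realType} (p : R) (p1 : 1 <= p) (alpha k0 : R) (w : int -> R).
Local Notation E := (lp p1).
Local Notation k := (kseq k0 w).
Local Notation xi := (control_measure p1 alpha k).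
Local Notation e_ := (lp_e p1).
Local Notation psi := (stable_exponent alpha xi).
Context (T : {linear E -> E}).
Hypotheses (alpha0 : 0 < alpha) (alpha2 : alpha < 2).
Hypotheses (k0_gt0 : 0 < k0) (w_gt0 : forall n, 0 < w n).
Hypothesis klalpha : in_lalpha alpha k.
Hypothesis Te : forall n, T (e_ n) = (w (n + 1))%:C *: e_ (n + 1).
Hypothesis bT : bounded_near T (nbhs (0 : E)).

Let k_ge0 n : 0 <= k n. Proof. by rewrite ltW// kseq_gt0. Qed.

Lemma adjoint_shift_e x n : dual E x -> adjoint T x (e_ n) = (w (n + 1))%:C * x (e_ (n + 1)).
Proof. by move=> dx; rewrite /adjoint /= Te dual_scale. Qed.

Lemma iter_adjoint_shift_e x n (m : nat) : dual E x ->
  k n * normc (iter m (adjoint T) x (e_ n)) = k (n + m%:Z) * normc (x (e_ (n + m%:Z))).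
Proof.
move=> dx; elim: m n => [|m ih] n; first by rewrite addr0.
rewrite iterS adjoint_shift_e; last exact: dual_iter_adjoint.
have -> : n + m.+1%:Z = (n + 1) + m%:Z by lia.
rewrite -ih (kseqS k0 _ w_gt0) normcM -[normc (_%:C)]/(Num.sqrt (_ ^+ 2 + 0 ^+ 2)).
by rewrite expr0n /= addr0 sqrtr_sqr gtr0_norm// mulrCA mulrA.
Qed.

(** By k_n w_(n+1) = k_(n+1) the n-th atom contributes to the exponent at x o T
    what the next one contributes at x. *)
Lemma stable_exponent_adjoint x : dual E x -> psi (adjoint T x) = psi x.
Proof.
move=> dx; have dTx : dual E (adjoint T x) by exact: adjoint_dual.
pose S (y : E -> R[i]^o) (n : int) : R :=
  k n `^ alpha * (`|Re (y (e_ n))| `^ alpha + `|Im (y (e_ n))| `^ alpha).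
have psiE y : dual E y ->
    psi y = - fine ((2^-1)%:E * \esum_(n in [set: int]) (S y n)%:E)%E.
  by move=> dy; rewrite -(stable_integralE k alpha0 dy).
have SE n : S (adjoint T x) n = S x (n + 1).
  rewrite /S (adjoint_shift_e n dx) (kseqS k0 _ w_gt0).
  case: (x (e_ (n + 1))) => a b; set u := w (n + 1).
  have u0 : 0 < u by exact: w_gt0.
  rewrite /= !mul0r subr0 addr0 !normrM (gtr0_norm u0) !powRM// ?ltW//.
  by ring.
rewrite (psiE _ dTx) (psiE _ dx); congr (- fine (_ * _)%E).
have bij1 : set_bij [set: int] [set: int] (fun n : int => n + 1).
  by split=> [//|i j _ _ /addIr//|m _]; exists (m - 1) => //; rewrite subrK.
rewrite [RHS](reindex_esum _ _ _ (fun n => (S x n)%:E) bij1).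
by apply: eq_esum => n _; rewrite SE.
Qed.

Lemma stable_exponent_iter_adjoint x n : dual E x -> psi (iter n (adjoint T) x) = psi x.
Proof.
move=> dx; elim: n => [//|n ih].
rewrite iterS (stable_exponent_adjoint (dual_iter_adjoint n bT dx)).
exact: ih.
Qed.

Section decay.
Variables (qm qp : int) (etam etap : R).
Hypothesis alphap : alpha < p.
Hypotheses (qm0 : 0 <= qm) (qp0 : 0 <= qp).
Hypothesis wm : forall l, l <= - qm -> (w l)^-1 <= etam.
Hypothesis wp : forall l, qp <= l -> w l <= etap.
Hypotheses (etam1 : etam < 1) (etap1 : etap < 1).

Let p0 : 0 < p. Proof. exact: lt_le_trans p1. Qed.
Let etam_gt0 : 0 < etam.
Proof. by apply: lt_le_trans (wm (lexx _)); rewrite invr_gt0. Qed.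
Let etap_gt0 : 0 < etap.
Proof. exact: lt_le_trans (wp (lexx _)). Qed.

Let theta := 2 * alpha / p - 1.
Let eta := Num.max (etam `^ theta) etap.

Let theta_lt1 : theta < 1.
Proof.
rewrite /theta ltrBlDr (_ : 1 + 1 = 2) // ltr_pdivrMr// ltr_pM2l//.
Qed.

Lemma decay_rate_gt0 : 0 < eta.
Proof. by rewrite lt_max etap_gt0 orbT. Qed.

(** The strict gap comes from theta < 1, that is from alpha < p. *)
Lemma etam_lt_rate : etam < eta.
Proof.
rewrite lt_max; apply/orP; left.
have {1}-> : etam = etam `^ theta * etam `^ (1 - theta).
  by rewrite -powRD ?[theta + _]addrC ?subrK ?powRr1 ?ltW// gt_eqF// implybT.
rewrite -[ltRHS]mulr1 ltr_pM2l ?powR_gt0//.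
have one : (1 : R) `^ (1 - theta) = 1 by rewrite powR1.
rewrite -[ltRHS]one.
by apply: gt0_ltr_powR; rewrite ?nnegrE ?subr_gt0// ltW.
Qed.

(** This is about the case eta > 1, where eta = etam^(2 alpha/p - 1) and the
    product is etam^(2 alpha/p). *)
Lemma etamM_rate_le1 : etam * eta <= 1.
Proof.
rewrite -ler_pdivlMl// mulr1 ge_max; apply/andP; split; last first.
  by rewrite (le_trans (ltW etap1))// invf_ge1// ltW.
rewrite -[leRHS]mul1r ler_pdivlMr//.
have -> : etam `^ theta * etam = etam `^ (2 * alpha / p).
  rewrite -[X in _ * X](powRr1 (ltW etam_gt0)) -powRD /theta ?subrK//.
  by rewrite [etam == 0]gt_eqF// implybT.
have one : (1 : R) `^ (2 * alpha / p) = 1 by rewrite powR1.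
rewrite -[leRHS]one.
by apply: ge0_ler_powR; rewrite ?nnegrE ?divr_ge0 ?mulr_ge0// ltW.
Qed.

Let b := alpha / 2.
Let b0 : 0 < b. Proof. by rewrite divr_gt0. Qed.
Let kap m := k m `^ b.
Let rho := eta `^ b.

Lemma shift_correlation_decay : exists2 C : R, 0 < C & forall n : nat,
  (\esum_(m in [set: int]) (kap m * kap (m + n%:Z))%:E <= (C * rho ^+ n)%:E)%E.
Proof.
have mono (u v : R) : 0 <= u -> u <= v -> u `^ b <= v `^ b.
  move=> u0 uv; apply: ge0_ler_powR; rewrite ?nnegrE ?(ltW b0)//.
  exact: le_trans uv.
have kpos m : 0 < k m by exact: kseq_gt0.
have kstep m : k (m + 1) = w (m + 1) * k m by rewrite kseqS.
have eta0 := decay_rate_gt0.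
apply: (esum_shift_product_le (a := etam `^ b) (Q := (`|qm| + `|qp|)%N)).
- by move=> m; exact: powR_ge0.
- rewrite (eq_esum (b := fun m => (k m `^ alpha)%:E)); first exact: esum_k_lty.
  move=> m _; congr EFin; rewrite /kap /b -powRD -?splitr//.
  by rewrite [k m == 0]gt_eqF// implybT.
- exact: powR_gt0.
- by apply: gt0_ltr_powR; rewrite ?nnegrE ?etam_lt_rate// ltW.
- rewrite -powRM ?(ltW etam_gt0) ?(ltW eta0)//.
  have one : (1 : R) `^ b = 1 by rewrite powR1.
  rewrite -[leRHS]one.
  by apply: mono; [rewrite mulr_ge0// ltW|exact: etamM_rate_le1].
- move=> m mQ; rewrite /kap kstep powRM ?(ltW (w_gt0 _)) ?(ltW (kpos _))//; apply: ler_wpM2r; first exact: powR_ge0.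
  apply: mono; first exact: ltW.
  by rewrite le_max; apply/orP; right; apply: wp; exact: (le_shift_of_absz qm0 qp0 mQ).
- move=> m mQ; rewrite /kap.
  have -> : k (m - 1) = (w m)^-1 * k m.
    by have := kstep (m - 1); rewrite subrK => ->; rewrite mulKf// gt_eqF.
  rewrite powRM ?invr_ge0 ?(ltW (w_gt0 _)) ?(ltW (kpos _))//; apply: ler_wpM2r; first exact: powR_ge0.
  by apply: mono; [rewrite invr_ge0 ltW|apply: wm; exact: (le_oppr_of_absz qm0 qp0 mQ)].
Qed.

(** By [iter_adjoint_shift_e] the iterates of T translate k_m |y_m|; what remains
    after bounding the values of x and y at the basis by their norms is the
    correlation of k^(alpha/2) with its n-th translate. *)
Lemma exponent_defect_decay : exists2 C : R, 0 < C & forall (n : nat) x y,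
  dual E x -> dual E y ->
  `|psi (x + iter n (adjoint T) y) - psi x - psi (iter n (adjoint T) y)|
    <= C * (dual_norm x `^ b * dual_norm y `^ b) * rho ^+ n.
Proof.
have [C C0 hC] := shift_correlation_decay.
exists (4 * C); first by rewrite mulr_gt0.
move=> n x y dx dy; have dY := dual_iter_adjoint n bT dy.
rewrite -lee_fin; apply: le_trans (stable_exponent_defect alpha0 alpha2 k_ge0 klalpha dx dY) _.
set N := dual_norm x `^ b * dual_norm y `^ b.
have N0 : 0 <= N by rewrite mulr_ge0 ?powR_ge0.
rewrite (_ : 4 * C * N * rho ^+ n = 4 * (N * (C * rho ^+ n))); last by ring.
rewrite [leRHS]EFinM; apply: lee_wpmul2l => //.
apply: (@le_trans _ _ (N%:E * \esum_(m in [set: int]) (kap m * kap (m + n%:Z))%:E)%E); last first.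
  by rewrite [leRHS]EFinM; apply: lee_wpmul2l => //; exact: hC.
apply: le_trans (esumZl_le _ N0 _); last first.
  by move=> m; rewrite lee_fin mulr_ge0 ?powR_ge0.
apply: le_esum => m _; rewrite -EFinM lee_fin -/b.
have mono (u v : R) : 0 <= u -> u <= v -> u `^ b <= v `^ b.
  move=> u0 uv; apply: ge0_ler_powR; rewrite ?nnegrE ?(ltW b0)//.
  exact: le_trans uv.
have kE : k m `^ alpha = kap m * k m `^ b.
  rewrite /kap -powRD -?splitr//.
  by rewrite [k m == 0]gt_eqF ?kseq_gt0// implybT.
have shiftE : k m `^ b * normc (iter n (adjoint T) y (e_ m)) `^ b =
    kap (m + n%:Z) * normc (y (e_ (m + n%:Z))) `^ b.
  rewrite -(powRM _ (k_ge0 _) (normc_ge0 _)) (iter_adjoint_shift_e m n dy).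
  exact: (powRM _ (k_ge0 _) (normc_ge0 _)).
rewrite kE (_ : forall u1 u2 u3 u4 : R, u1 * u2 * (u3 * u4) = u1 * u3 * (u2 * u4)); last by move=> *; ring.
rewrite shiftE (_ : forall u1 u2 u3 u4 : R, u1 * u2 * (u3 * u4) = u2 * u4 * (u1 * u3)); last by move=> *; ring.
apply: ler_wpM2r; first by rewrite mulr_ge0 ?powR_ge0.
apply: ler_pM; [exact: powR_ge0|exact: powR_ge0| |].
  exact: (mono _ _ (normc_ge0 _) (normc_dual_e_le m dx)).
exact: (mono _ _ (normc_ge0 _) (normc_dual_e_le (m + n%:Z) dy)).
Qed.

End decay.
End weighted_shift_exponent.

(** * From the characteristic functional to Borel sets *)

Lemma indic_preimage {R : realType} (X Y : Type) (S : X -> Y) (A : set Y) x :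
  \1_(S @^-1` A) x = \1_A (S x) :> R.
Proof. by rewrite !indicE; congr (_%:R); congr nat_of_bool; apply/idP/idP; rewrite !inE. Qed.

Section indicator_integrals.
Context {d : measure_display} {X : measurableType d} {R : realType}.
Context (mu : probability X R).

Lemma EFin_Rintegral_indic (A : set X) : measurable A ->
  (\int[mu]_x \1_A x)%:E = mu A.
Proof.
move=> mA; rewrite /Rintegral integral_indic// setIT fineK//.
exact: fin_num_measure.
Qed.

End indicator_integrals.

Section characteristic_functional.
Context {R : realType} {V : normedModType R[i]}.
Context (mu : probability (borel V) R) (xi : {measure set (borel V) -> \bar R}) (alpha : R).
Hypothesis mu_xi : has_stable_charfun mu alpha xi.

Lemma continuous_borel (T : V -> V) : continuous T ->
  measurable_fun setT (T : borel V -> borel V).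
Proof.
move=> /continuousP cT; apply: (measurability (rT := borel V) (@open V) erefl).
by move=> _ [U oU <-]; rewrite setTI; apply: sub_sigma_algebra; exact: cT.
Qed.

Lemma trig_funs_measurable (f : borel V -> R) : @trig_funs R V f -> measurable_fun setT f.
Proof.
move=> [x [a [dx ->]]].
have mx := dual_measurable_Re dx.
have mxa : measurable_fun setT (fun z : borel V => Re (x z) + a).
  by apply: measurable_funD; [exact: mx|exact: measurable_cst].
apply: (measurableT_comp _ mxa).
by apply: continuous_measurable_fun; exact: continuous_cos.
Qed.

(** The characteristic functional is real, hence the integral of sin (Re x)
    vanishes. *)
Lemma Rintegral_trig_fun x a : dual V x ->
  \int[mu]_z cos (Re (x z) + a) = cos a * expR (stable_exponent alpha xi x).
Proof.
move=> dx; have := mu_xi dx; rewrite /charfun /cintegral /expi /= => -[hcos hsin].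
have mcos : measurable_fun setT (fun z : borel V => cos (Re (x z))).
  apply: (measurableT_comp _ (dual_measurable_Re dx)).
  by apply: continuous_measurable_fun; exact: continuous_cos.
have msin : measurable_fun setT (fun z : borel V => sin (Re (x z))).
  apply: (measurableT_comp _ (dual_measurable_Re dx)).
  by apply: continuous_measurable_fun; exact: continuous_sin.
have msin' : measurable_fun setT (fun z : borel V => - sin a * sin (Re (x z))).
  by apply: measurable_funM; [exact: measurable_cst|exact: msin].
have bcos z : `|cos (Re (x z))| <= 1 by rewrite ler_norml cos_geN1 cos_le1.
have bsin z : `|sin (Re (x z))| <= 1 by rewrite ler_norml sin_geN1 sin_le1.
have bsin' z : `|- sin a * sin (Re (x z))| <= `|- sin a|.
  by rewrite normrM ler_piMr.
have -> : (fun z => cos (Re (x z) + a)) = fun z => cos a * cos (Re (x z)) + (- sin a * sin (Re (x z))).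
  by apply/funext => z; rewrite cosD; ring.
rewrite (Rintegral_lin mu (cos a) mcos msin' bcos bsin') hcos.
have := bounded_integrable mu msin bsin => isin.
by rewrite (RintegralZl (- sin a) measurableT isin) hsin mulr0 addr0.
Qed.

Lemma dual_norm_phase (a : R[i]) (y : V -> R[i]^o) : normc a = 1 ->
  dual_norm (a *: y) = dual_norm y.
Proof.
move=> a1; rewrite /dual_norm; congr sup; apply/seteqP.
have E z : normc ((a *: y) z) = normc (y z).
  by rewrite -[(a *: y) z]/(a * y z) normcM a1 mul1r.
by split=> _ [z z1 <-]; exists z.
Qed.

End characteristic_functional.

Section borel_mixing.
Context {R : realType} (p : R) (p1 : 1 <= p).
Local Notation E := (lp p1).
Context (mu : probability (borel E) R) (T : E -> E).
Hypothesis cT : continuous T.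

Let mT := continuous_borel cT.

Lemma blc_trig_borel (A : set (borel E)) : measurable A -> blc (@trig_funs R E) \1_A.
Proof. by move=> mA; apply: blc_trig_indic; exact: borel_half_spaces. Qed.

Lemma invariant_of_trig : (forall f : borel E -> R, @trig_funs R E f ->
    \int[mu]_z f (T z) = \int[mu]_z f z) -> invariant_measure mu T.
Proof.
move=> h A mA.
have hA := blc_preserving (mu := mu) (@trig_funs_measurable R E)
  (@trig_funs_bounded R E) mT h (blc_trig_borel mA).
have mTA : measurable (T @^-1` A : set (borel E)) by rewrite -[X in measurable X]setTI; exact: mT.
apply: etrans (esym (EFin_Rintegral_indic mu mTA)) _.
apply: etrans _ (EFin_Rintegral_indic mu mA); congr EFin; rewrite -hA.
apply: eq_Rintegral => z _.
exact: indic_preimage.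
Qed.

Lemma measurable_iter n : measurable_fun setT (iter n T : borel E -> borel E).
Proof.
elim: n => [|n ih]; first exact: measurable_id.
exact: (measurableT_comp mT ih).
Qed.

Lemma mixing_of_trig : invariant_measure mu T ->
  (forall f g : borel E -> R, @trig_funs R E f -> @trig_funs R E g ->
    decorrelates mu (fun n => iter n T) f g) -> mixing_measure mu T.
Proof.
move=> inv h A B mA mB.
have muS n (C : set (borel E)) : measurable C -> mu (iter n T @^-1` C) = mu C.
  elim: n C => [//|n ih] C mC.
  rewrite -[_ @^-1` _]/(iter n T @^-1` (T @^-1` C)) ih ?inv//.
  by rewrite -[X in measurable X]setTI; exact: mT.
have hAB := blc_decorrelates (mu := mu) (@trig_funs_measurable R E)
  (@trig_funs_bounded R E) measurable_iter muS h (blc_trig_borel mA) (blc_trig_borel mB).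
have mTB n : measurable (iter n T @^-1` B : set (borel E)).
  by rewrite -[X in measurable X]setTI; exact: (measurable_iter n).
have prodE : (mu A * mu B)%E = ((\int[mu]_x \1_A x) * (\int[mu]_x \1_B x))%:E.
  by rewrite EFinM (EFin_Rintegral_indic mu mA) (EFin_Rintegral_indic mu mB).
rewrite prodE.
have -> : (fun n => mu (A `&` iter n T @^-1` B)) =
    (fun n => (\int[mu]_x (\1_A x * \1_B (iter n T x)))%:E).
  apply/funext => n.
  apply: etrans (esym (EFin_Rintegral_indic mu (measurableI _ _ mA (mTB n)))) _.
  congr EFin; apply: eq_Rintegral => z _; rewrite indicI; congr (_ * _).
by apply: cvg_EFin; [near=> n|exact: hAB].
Unshelve. all: by end_near.
Qed.

End borel_mixing.

(** * Weighted shifts with a stable invariant measure *)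

Section stable_weighted_shift.
Context {R : realType} (p : R) (p1 : 1 <= p) (alpha k0 : R) (w : int -> R).
Local Notation E := (lp p1).
Local Notation k := (kseq k0 w).
Local Notation xi := (control_measure p1 alpha k).
Local Notation e_ := (lp_e p1).
Local Notation psi := (stable_exponent alpha xi).
Context (mu : probability (borel E) R) (T : {linear E -> E}).
Hypotheses (alpha0 : 0 < alpha) (alpha2 : alpha < 2).
Hypotheses (k0_gt0 : 0 < k0) (w_gt0 : forall n, 0 < w n).
Hypothesis klalpha : in_lalpha alpha k.
Hypothesis mu_xi : has_stable_charfun mu alpha xi.
Hypothesis Te : forall n, T (e_ n) = (w (n + 1))%:C *: e_ (n + 1).
Hypothesis bT : bounded_near T (nbhs (0 : E)).

Let cT : continuous T. Proof. by apply/linear_bounded_continuous. Qed.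

Lemma weighted_shift_invariant : invariant_measure mu T.
Proof.
apply: (invariant_of_trig cT) => f [x [a [dx ->]]].
have dTx : dual E (adjoint T x) := adjoint_dual bT dx.
rewrite (Rintegral_trig_fun mu_xi a dx).
rewrite -(stable_exponent_adjoint alpha0 k0_gt0 w_gt0 Te bT dx).
exact: (Rintegral_trig_fun mu_xi a dTx).
Qed.

Lemma codiff_sup_bigO (Cd : (E -> R[i]^o) -> (E -> R[i]^o) -> R[i]) (C eta : R) :
  0 < C -> 0 <= eta ->
  (forall n x y, dual E x -> dual E y -> normc (Cd x (iter n (adjoint T) y)) <=
    C * (dual_norm x `^ (alpha / 2) * dual_norm y `^ (alpha / 2)) * (eta `^ (alpha / 2)) ^+ n) ->
  bigO_nat (codiff_sup Cd T alpha) (fun n => eta `^ (alpha * n%:R / 2)).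
Proof.
move=> C0 eta0 hC; exists C => // n.
have rateE : `|eta `^ (alpha * n%:R / 2)| = (eta `^ (alpha / 2)) ^+ n.
  rewrite ger0_norm ?powR_ge0// (_ : alpha * n%:R / 2 = alpha / 2 * n%:R).
    by rewrite powRrM powR_mulrn ?powR_ge0.
  by rewrite mulrAC.
rewrite rateE; set r := _ ^+ n.
have r0 : 0 <= r by rewrite exprn_ge0// powR_ge0.
(* a coordinate: the supremum of the empty set would be -oo *)
have c0 : (dual E `\ 0) (lp_coord p1 0).
  split; first exact: dual_lp_coord.
  move=> /= /(congr1 (fun f : E -> R[i]^o => f (e_ 0))).
  rewrite -[LHS]/((0 == 0 :> int)%:R : R[i]) eqxx.
  by move/eqP; rewrite oner_eq0.
rewrite gee0_abs.
  apply: ge_ereal_sup => _ [x [dx _]] [y [dy _]] <-; rewrite lee_fin.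
  have := hC n x y dx dy; rewrite -/r.
  set N := dual_norm x `^ _ * _; have N0 : 0 <= N by rewrite mulr_ge0 ?powR_ge0.
  move=> h; have [Nz|Nnz] := eqVneq N 0.
    by rewrite Nz invr0 mulr0 mulr_ge0// ltW.
  have Np : 0 < N by rewrite lt_neqAle eq_sym Nnz.
  by rewrite ler_pdivrMr// mulrAC.
apply: le_trans (ereal_sup_ubound _); last first.
  exists (lp_coord p1 0) => //; exists (lp_coord p1 0) => //; reflexivity.
by rewrite lee_fin divr_ge0 ?normc_ge0// mulr_ge0// powR_ge0.
Qed.

Section mixing.
Variables (C rho : R).
Hypotheses (rho0 : 0 <= rho) (rho1 : rho < 1).
Hypothesis defect : forall (n : nat) x y, dual E x -> dual E y ->
  `|psi (x + iter n (adjoint T) y) - psi x - psi (iter n (adjoint T) y)|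
    <= C * (dual_norm x `^ (alpha / 2) * dual_norm y `^ (alpha / 2)) * rho ^+ n.

Lemma exponent_asymptotic_additivity x y : dual E x -> dual E y ->
  psi (x + iter n (adjoint T) y) @[n --> \oo] --> psi x + psi y.
Proof.
move=> dx dy; apply/subr_cvg0; set N := C * (dual_norm x `^ (alpha / 2) * dual_norm y `^ (alpha / 2)).
apply/cvgr0Pnorm_le => e e0.
have lim : N * rho ^+ n @[n --> \oo] --> 0.
  rewrite -[X in _ --> X](mulr0 N); apply: cvgMr.
  by apply: cvg_expr; rewrite ger0_norm.
have := cvgr0_norm_le _ lim _ e0; move=> /(_ eventually_filter).
apply: filterS => n; apply: le_trans; apply: le_trans (ler_norm _).
have := defect n dx dy.
by rewrite (stable_exponent_iter_adjoint alpha0 k0_gt0 w_gt0 Te bT n dy) opprD addrA.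
Qed.

(** The product of cos (Re x + a) with cos (Re y + b) o T^n is a combination of
    the trigonometric functions of x + y o T^n and x - y o T^n, whose integrals
    converge by asymptotic additivity of the exponent. *)
Lemma weighted_shift_mixing : mixing_measure mu T.
Proof.
apply: (mixing_of_trig cT weighted_shift_invariant).
move=> _ _ [x [a [dx ->]]] [y [b [dy ->]]]; rewrite /decorrelates.
rewrite (Rintegral_trig_fun mu_xi a dx) (Rintegral_trig_fun mu_xi b dy).
have intE n : \int[mu]_z (cos (Re (x z) + a) * cos (Re (y (iter n T z)) + b)) =
    1 / 2 * (cos (a + b) * expR (psi (x + iter n (adjoint T) y))) +
    1 / 2 * (cos (a - b) * expR (psi (x + iter n (adjoint T) (- y)))).
  pose Y := iter n (adjoint T) y; have dY : dual E Y := dual_iter_adjoint n bT dy.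
  have dp := dualD dx dY; have dm := dualD dx (dualN dY).
  rewrite iter_adjointN -/Y.
  rewrite -(Rintegral_trig_fun mu_xi (a + b) dp) -(Rintegral_trig_fun mu_xi (a - b) dm).
  pose F (z : borel E) : R := cos (Re ((x + Y) z) + (a + b)).
  pose G (z : borel E) : R := cos (Re ((x - Y) z) + (a - b)).
  have tF : @trig_funs R E F.
    by exists (x + Y), (a + b); split; [exact: dp|reflexivity].
  have tG : @trig_funs R E G.
    by exists (x - Y), (a - b); split; [exact: dm|reflexivity].
  have mF := trig_funs_measurable tF; have mG := trig_funs_measurable tG.
  have bF z : `|F z| <= 1 by rewrite ler_norml cos_geN1 cos_le1.
  have bG z : `|G z| <= 1 by rewrite ler_norml cos_geN1 cos_le1.
  have mG' : measurable_fun setT (fun z => 1 / 2 * G z).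
    by apply: measurable_funM; [exact: measurable_cst|exact: mG].
  have bG' z : `|1 / 2 * G z| <= `|1 / 2| by rewrite normrM ler_piMr.
  rewrite -/(F _) -/(G _) -[in RHS](RintegralZl (1 / 2) measurableT (bounded_integrable mu mG bG)).
  rewrite -(Rintegral_lin mu (1 / 2) mF mG' bF bG').
  apply: eq_Rintegral => z _; rewrite cosM /F /G.
  rewrite -(iter_adjointE T y n z) -/Y.
  rewrite -[(x + Y) z]/(x z + Y z) -[(x - Y) z]/(x z - Y z) !ReD.
  have ReN (t : R[i]) : Re (- t) = - Re t by case: t.
  rewrite ReN; congr (_ * cos _ + _ * cos _); ring.
have -> : (fun n => \int[mu]_z (cos (Re (x z) + a) * cos (Re (y (iter n T z)) + b))) =
    fun n => 1 / 2 * (cos (a + b) * expR (psi (x + iter n (adjoint T) y))) +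
    1 / 2 * (cos (a - b) * expR (psi (x + iter n (adjoint T) (- y)))).
  by apply/funext => n; exact: intE.
have limE u : dual E u -> expR (psi (x + iter n (adjoint T) u)) @[n --> \oo] --> expR (psi x + psi u).
  move=> du; have h := exponent_asymptotic_additivity dx du.
  by apply: continuous_cvg h; exact: continuous_expR.
have -> : cos a * expR (psi x) * (cos b * expR (psi y)) =
    1 / 2 * (cos (a + b) * expR (psi x + psi y)) +
    1 / 2 * (cos (a - b) * expR (psi x + psi (- y))).
  rewrite (stable_exponentN alpha xi y) mulrACA cosM -expRD mulrDl -!mulrA.
  reflexivity.
apply: cvgD; apply: cvgMr; apply: cvgMr.
  exact: (limE y dy).
exact: (limE (- y) (dualN dy)).
Qed.

End mixing.
End stable_weighted_shift.

Theorem proposition5p2 (R : realType) (alpha p : R) (p1 : 1 <= p)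
    (k0 : R) (w : int -> R)
    (mu : probability (borel (lp p1)) R)
    (T : {linear lp p1 -> lp p1}) :
  0 < alpha -> alpha < 2 -> alpha != 1 ->
  0 < k0 -> (forall n, 0 < w n) ->
  in_lalpha alpha (kseq k0 w) ->
  has_stable_charfun mu alpha (control_measure p1 alpha (kseq k0 w)) ->
  (forall n, T (lp_e p1 n) = (w (n + 1))%:C *: lp_e p1 (n + 1)) ->
  bounded_near T (nbhs (0 : lp p1)) ->
  invariant_measure mu T /\
  (forall (qm qp : int) (etam etap : R),
    alpha < p -> p <= 2 ->
    0 <= qm -> 1 <= qp ->
    ereal_sup [set ((w l)^-1)%:E | l in [set l : int | l <= - qm]] = etam%:E ->
    ereal_sup [set (w l)%:E | l in [set l : int | qp <= l]] = etap%:E ->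
    etam < 1 -> etap < 1 ->
    etap `^ (p / 2) != etam `^ (alpha - p / 2) ->
    [/\ bigO_nat (codiff_sup (codiff_eq mu) T alpha)
          (fun n => Num.max (etam `^ (2 * alpha / p - 1)) etap
                      `^ (alpha * n%:R / 2)),
        bigO_nat (codiff_sup (codiff_neq mu) T alpha)
          (fun n => Num.max (etam `^ (2 * alpha / p - 1)) etap
                      `^ (alpha * n%:R / 2)) &
        1 / 2 < alpha -> p < 2 * alpha -> mixing_measure mu T]).
Proof.
move=> alpha0 alpha2 _ k0_gt0 w_gt0 klalpha mu_xi Te bT; split.
  exact: (weighted_shift_invariant alpha0 k0_gt0 w_gt0 mu_xi Te bT).
move=> qm qp etam etap alphap _ qm0 qp1 etamE etapE etam1 etap1 _.
have qp0 : 0 <= qp by apply: le_trans qp1.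
have p0 : 0 < p := lt_le_trans ltr01 p1.
have wm l : l <= - qm -> (w l)^-1 <= etam.
  by move=> lq; rewrite -lee_fin -etamE; apply: ereal_sup_ubound; exists l.
have wp l : qp <= l -> w l <= etap.
  by move=> lq; rewrite -lee_fin -etapE; apply: ereal_sup_ubound; exists l.
have etam_gt0 : 0 < etam by apply: lt_le_trans (wm _ (lexx _)); rewrite invr_gt0.
have [C C0 hC] := exponent_defect_decay alpha0 alpha2 k0_gt0 w_gt0 klalpha Te bT
  alphap qm0 qp0 wm wp etam1 etap1.
set eta := Num.max _ _ in hC *.
have eta0 : 0 <= eta by rewrite le_max powR_ge0.
have normcR (r : R) : normc r%:C = `|r| by rewrite /normc /= expr0n /= addr0 sqrtr_sqr.
split.
- apply: (codiff_sup_bigO C0 eta0) => n x y dx dy.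
  have dY := dual_iter_adjoint n bT dy.
  rewrite (codiff_eqE mu_xi dx dY) normcR -iter_adjointN.
  rewrite -(dual_norm_phase (a := -1) y); last by rewrite normcN normc1.
  by rewrite scaleN1r; exact: (hC n x (- y) dx (dualN dy)).
- apply: (codiff_sup_bigO C0 eta0) => n x y dx dy.
  have dY := dual_iter_adjoint n bT dy.
  rewrite (codiff_neqE mu_xi dx dY) normcR -iter_adjointZ.
  rewrite -(dual_norm_phase (a := 'i%C) y); last by rewrite /normc /= expr0n /= add0r expr1n sqrtr1.
  exact: (hC n x _ dx (dualZ 'i%C dy)).
- move=> _ p2alpha.
  have eta_lt1 : eta < 1.
    rewrite gt_max etap1 andbT.
    have theta0 : 0 < 2 * alpha / p - 1 by rewrite subr_gt0 ltr_pdivlMr// mul1r.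
    have one : (1 : R) `^ (2 * alpha / p - 1) = 1 by rewrite powR1.
    by rewrite -[ltRHS]one; apply: gt0_ltr_powR; rewrite ?nnegrE// ltW.
  have rho1 : eta `^ (alpha / 2) < 1.
    have one : (1 : R) `^ (alpha / 2) = 1 by rewrite powR1.
    by rewrite -[ltRHS]one; apply: gt0_ltr_powR; rewrite ?nnegrE ?divr_gt0.
  exact: (weighted_shift_mixing alpha0 k0_gt0 w_gt0 mu_xi Te bT (powR_ge0 _ _) rho1 hC).
Qed.
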